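(* Let $0<\alpha<1$ be a real number and $G$ a finite abelian group. For any $c<\min(\alpha,\log 2)$ there is a $K>0$ (depending on $\alpha,G,c$) such that the following holds for every $n$. Let $X$ be a random symmetric $n\times n$ matrix with entries $X_{ij}\in\mathbb{Z}$ such that the entries $X_{ij}$ for $i\le j$ are independent, and such that for any prime $p$ dividing $|G|$, any $t\in\mathbb{Z}/p\mathbb{Z}$ and any $i\le j$, we have $\mathbb{P}(X_{ij}\equiv t \pmod p)\le 1-\alpha$. Then $$\left|\mathbb{E}(\#\operatorname{Sur}(\operatorname{cok}(X),G))-|\wedge^2G|\right|\le Ke^{-cn}.$$
   Context: For an $n\times n$ integer matrix $X$, $\operatorname{cok}(X)=\mathbb{Z}^n/X\mathbb{Z}^n$ is the quotient by the column space. $\operatorname{Sur}(A,B)$ is the set of surjective group homomorphisms $A\to B$. $\wedge^2G$ is the quotient of $G\otimes_{\mathbb{Z}} G$ by the subgroup generated by the elements $g\otimes g$. The entries are not assumed identically distributed. *)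

(* Defs.v *)
From HB Require Import structures.
From mathcomp Require Import all_boot all_order all_algebra.
From mathcomp Require Import generic_quotient ring_quotient.
From mathcomp Require Import finmap.
From mathcomp Require Import all_classical all_reals all_analysis.

Set Implicit Arguments.
Unset Strict Implicit.
Unset Printing Implicit Defensive.

Import Order.TTheory GRing.Theory Num.Theory.
Local Open Scope ring_scope.
Local Open Scope classical_set_scope.
Local Open Scope quotient_scope.

Section GeneratedSubgroup.
Variables (V : zmodType) (S : set V).

Definition gen_subgroup : {pred V} :=
  [pred v | `[< forall H : zmodClosed V,
                  (forall s, S s -> s \in H) -> v \in H >]].

Lemma gen_subgroup_zmod_closed : zmod_closed gen_subgroup.
Proof.
split=> [|x y]; first by apply/asboolP => H _; exact: rpred0.
move=> /asboolP hx /asboolP hy; apply/asboolP => H SH.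
by apply: rpredB; [exact: hx|exact: hy].
Qed.

HB.instance Definition _ :=
  GRing.isZmodClosed.Build V gen_subgroup gen_subgroup_zmod_closed.

End GeneratedSubgroup.

Section Cokernel.
Variables (n : nat) (X : 'M[int]_n).

Definition colspan : {pred 'cV[int]_n} :=
  [pred v | `[< exists u : 'cV[int]_n, v = X *m u >]].

Lemma colspan_zmod_closed : zmod_closed colspan.
Proof.
split=> [|x y]; first by apply/asboolP; exists 0; rewrite mulmx0.
move=> /asboolP[u ->] /asboolP[v ->]; apply/asboolP.
by exists (u - v); rewrite mulmxBr.
Qed.

HB.instance Definition _ :=
  GRing.isZmodClosed.Build 'cV[int]_n colspan colspan_zmod_closed.

Definition cok := {ideal_quot colspan}.
HB.instance Definition _ := GRing.Zmodule.on cok.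

End Cokernel.

Definition Sur (A B : zmodType) : set (A -> B) :=
  [set f | zmod_morphism f /\ forall b, exists a, f a = b].
Arguments Sur : clear implicits.

(* [fset_set] of an infinite set is empty; [num_elts] is only applied below to
   sets that are finite ([finite_Sur_cok], [finite_wedge2]). *)
Definition num_elts (T : choiceType) (A : set T) : nat := #|` fset_set A|.

Section Tensor.
Variables A B : finZmodType.

(* As [A * B] is finite, [{ffun A * B -> int}] is the free abelian group on
   [A * B], with basis the [free_gen a b]. *)
Definition free_gen (a : A) (b : B) : {ffun A * B -> int} :=
  [ffun x => (x == (a, b))%:R].

Definition bilinear_relations : set {ffun A * B -> int} :=
  [set r | (exists a a' b,
              r = free_gen (a + a') b - free_gen a b - free_gen a' b) \/
           (exists a b b',
              r = free_gen a (b + b') - free_gen a b - free_gen a b')].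

Definition tensor := {ideal_quot gen_subgroup bilinear_relations}.
HB.instance Definition _ := GRing.Zmodule.on tensor.

Definition tens (a : A) (b : B) : tensor :=
  \pi_({ideal_quot gen_subgroup bilinear_relations}) (free_gen a b).

End Tensor.

Section Wedge2.
Variable G : finZmodType.

Definition wedge2 :=
  {ideal_quot gen_subgroup [set tens g g | g in [set: G]]}.
HB.instance Definition _ := GRing.Zmodule.on wedge2.

End Wedge2.

Lemma finite_Sur_cok (n : nat) (X : 'M[int]_n) (G : finZmodType) :
  finite_set (Sur (cok X) G).
Proof.
pose F (g : {ffun 'I_n -> G}) (x : {ideal_quot colspan X}) :=
  \sum_i g i *~ (repr x) i 0.
apply: (sub_finite_set _ (finite_image F (@finite_finset _ setT))).
move=> f [fB _].
pose fA := GRing.isZmodMorphism.Build _ _ f fB.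
pose f' : {additive cok X -> G} := HB.pack f fA.
pose p : {additive 'cV[int]_n -> {ideal_quot colspan X}} :=
  \pi_{ideal_quot colspan X}.
pose q : {additive 'cV[int]_n -> G} := f' \o p.
exists [ffun i => q (delta_mx i 0)] => //; apply/funext => x.
rewrite /F -[in RHS](reprK x); move: (repr x) => v.
rewrite -[RHS]/(q v) {2}(matrix_sum_delta v).
rewrite !raddf_sum; apply: eq_bigr => i _.
rewrite ffunE big_ord1. 
by rewrite -raddfMz -scaler_int intz.
Qed.

Lemma ffunMzE (T : finType) (r : {ffun T -> int}) (m : int) (x : T) :
  (r *~ m) x = r x * m.
Proof.
case: m => m; first by rewrite -!pmulrn ffunMnE -mulr_natr natz.
by rewrite NegzE mulrNz mulrN ffunE -pmulrn ffunMnE -mulr_natr natz.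
Qed.

Lemma free_gen_sum (A B : finZmodType) (r : {ffun A * B -> int}) :
  r = \sum_x free_gen x.1 x.2 *~ r x.
Proof.
apply/ffunP => -[a b]; rewrite sum_ffunE (bigD1 (a, b)) //= big1.
  by rewrite addr0 ffunMzE ffunE eqxx mul1r.
by move=> [a' b'] /negPf ne; rewrite ffunMzE ffunE eq_sym ne mul0r.
Qed.

Lemma finite_wedge2 (G : finZmodType) : finite_set [set: wedge2 G].
Proof.
have [p pE] : {p : {additive {ffun G * G -> int} -> tensor G G} |
    p =1 \pi_{ideal_quot gen_subgroup (@bilinear_relations G G)}}.
  by eexists (\pi_{ideal_quot gen_subgroup (@bilinear_relations G G)}).
pose q : {additive tensor G G -> wedge2 G} :=
  \pi_{ideal_quot gen_subgroup [set tens g g | g in [set: G]]}.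
have pD a a' b : p (free_gen (a + a') b) = p (free_gen a b) + p (free_gen a' b).
  apply/eqP; rewrite -subr_eq0 -raddfD -raddfB opprD addrA.
  rewrite -(raddf0 p) !pE; apply/eqP/eqquotP.
  rewrite /Quotient.equiv /= subr0; apply/asboolP => H; apply.
  by left; exists a, a', b.
have p0 b : p (free_gen 0 b) = 0.
  by apply: (addrI (p (free_gen 0 b))); rewrite -pD !addr0.
have pMn a b m : p (free_gen a b) *+ m = p (free_gen (a *+ m) b).
  by elim: m => [|m IH]; rewrite ?mulr0n ?p0// !mulrS IH pD.
have cardM (a : G) : a *+ #|G| = 0.
  have: \sum_(x : G) x = \sum_(x : G) (x + a) by rewrite (reindex_inj (addIr a)).
  rewrite big_split /= sumr_const => /eqP.
  by rewrite eq_sym -subr_eq0 addrAC subrr add0r => /eqP.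
have G_gt0 : (0 < #|G|)%N by apply/card_gt0P; exists 0.
pose F (h : {ffun G * G -> 'I_#|G|}) : wedge2 G :=
  q (\sum_x p (free_gen x.1 x.2) *+ h x).
apply: (sub_finite_set _ (finite_image F (@finite_finset _ setT))).
move=> w _; have [t <-] : exists t, q t = w by exists (repr w); exact: reprK.
have [r <-] : exists r, p r = t by exists (repr t); rewrite pE; exact: reprK.
pose N : int := #|G|%:Z.
have pN a b : p (free_gen a b) *~ N = 0 by rewrite -pmulrn pMn cardM p0.
have N_gt0 : 0 < N by [].
have hlt x : (`|(r x %% N)%Z| < #|G|)%N.
  by rewrite -ltz_nat gez0_abs ?modz_ge0 ?gt_eqF// ltz_pmod.
exists [ffun x => Ordinal (hlt x)] => //; rewrite /F; congr (q _).
rewrite [in RHS](free_gen_sum r) raddf_sum; apply: eq_bigr => x _.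
rewrite ffunE /= raddfMz [in RHS](divz_eq (r x) N) mulrzDr.
rewrite mulrC mulrzA pN mul0rz add0r.
by rewrite pmulrn gez0_abs ?modz_ge0 ?gt_eqF.
Qed.

(* Mutual independence of a finite family of [int]-valued random variables,
   [int] carrying its discrete sigma-algebra. *)
Definition mutually_independent (R : realType) (d : measure_display)
    (T : measurableType d) (P : probability T R) (I : finType)
    (Y : I -> T -> int) : Prop :=
  forall (J : {set I}) (B : I -> set int),
    fine (P (\bigcap_(i in [set` J]) (Y i @^-1` B i))) =
    \prod_(i in J) fine (P (Y i @^-1` B i)).

Definition upper_index (n : nat) := {ij : 'I_n * 'I_n | (ij.1 <= ij.2)%N}.

Record random_symmetric_matrix (R : realType) (d : measure_display)
    (T : measurableType d) (P : probability T R) (n : nat)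
    (X : T -> 'M[int]_n) : Prop := {
  rsm_measurable : forall i j (B : set int), measurable [set w | B (X w i j)];
  rsm_symmetric : forall w, (X w)^T = X w;
  rsm_independent : mutually_independent P
    (fun (ij : upper_index n) w => X w (val ij).1 (val ij).2) }.

(* Main.v *)
(* A surjection cok(X) -> G is a family F = (F_1, ..., F_n) generating G with
   sum_i F_i X_ij = 0 for every j.  With dual group G^ and N = #|G|, Fourier inversion
   gives P(FX = 0) = N^-n sum_C E w(sum_ij C_j(F_i) X_ij) over C in (G^)^n, and
   by independence the expectation is a product over i <= j, whose coefficient
   at i < j is C_j(F_i) + C_i(F_j).

   Call F a code if every nonzero character is nonzero on more than d of the F_i,
   where d is a small multiple of n.  If F is a code, either a quadratic number
   of coefficients is nonzero, and the term is exp(-const n^2), or C = r F + D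
   with r a skew bilinear form on G and D supported on few indices.  The terms with
   r alternating and D = 0 are equal to 1; they give the main term, the
   alternating forms on G being the dual of its exterior square.  The other
   terms of this kind are summed over all F before being bounded: for fixed
   (r, D) the average over F is the probability that each column satisfies a
   nontrivial linear equation, at most (1 - alpha)^(n - o(n)), and restricting to
   codes costs the proportion 2^(-n + o(n)) of non-codes.

   A generating F that is not a code becomes one, for a proper subgroup H,
   after deleting few indices.  The deleted rows must satisfy a nontrivial
   relation in each column, of probability (1 - alpha)^(n - o(n)), while the
   other rows equidistribute in H, which compensates the number of such F. *)

From HB Require Import structures.
From mathcomp Require Import all_boot all_order all_algebra all_fingroup.
From mathcomp Require Import all_solvable all_field all_character.
From mathcomp Require Import ring lra zify.
Require Import Defs.

Set Implicit Arguments.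
Unset Strict Implicit.
Unset Printing Implicit Defensive.

Import Order.TTheory GRing.Theory Num.Theory.
Local Open Scope ring_scope.

(** * Characters of a finite abelian group, written additively *)

Section Dual.
Variables (a : nat) (A : finZmodType).

(** For a <= 1 the type ['Z_a] is Z/2 rather than Z/a. Later hypotheses on a coefficient y therefore
    include [y *+ a = 0], which keeps the trivial group harmless. *)
Definition dual_pred : {pred {ffun A -> 'Z_a}} :=
  [pred f : {ffun A -> 'Z_a} | [forall x, forall y, f (x - y) == f x - f y]].

Lemma dual_predP (f : {ffun A -> 'Z_a}) :
  reflect (forall x y, f (x - y) = f x - f y) (f \in dual_pred).
Proof.
apply: (iffP forallP) => [h x y|h x]; first by have /forallP/(_ y)/eqP := h x.
by apply/forallP => y; rewrite h.
Qed.

Lemma dual_zmod_closed : zmod_closed dual_pred.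
Proof.
split=> [|f g /dual_predP fB /dual_predP gB].
  by apply/dual_predP => x y; rewrite !ffunE subr0.
by apply/dual_predP => x y; rewrite !ffunE fB gB; ring.
Qed.

HB.instance Definition _ :=
  GRing.isZmodClosed.Build {ffun A -> 'Z_a} dual_pred dual_zmod_closed.

Record dual := Dual { dual_val : {ffun A -> 'Z_a}; dual_valP : dual_val \in dual_pred }.

HB.instance Definition _ := [isSub for dual_val].
HB.instance Definition _ := [Finite of dual by <:].
HB.instance Definition _ := [SubChoice_isSubZmodule of dual by <:].

Definition dapp (chi : dual) (x : A) : 'Z_a := dual_val chi x.

Lemma dapp_zmod_morphism (chi : dual) : zmod_morphism (dapp chi).
Proof. exact: (dual_predP _ (dual_valP chi)). Qed.

HB.instance Definition _ (chi : dual) :=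
  GRing.isZmodMorphism.Build A ('Z_a) (dapp chi) (dapp_zmod_morphism chi).

Lemma dapp0 x : dapp 0 x = 0. Proof. by rewrite /dapp /= ffunE. Qed.
Lemma dappD (c d : dual) x : dapp (c + d) x = dapp c x + dapp d x.
Proof. by rewrite /dapp /= ffunE. Qed.
Lemma dappN (c : dual) x : dapp (- c) x = - dapp c x.
Proof. by rewrite /dapp /= ffunE. Qed.
Lemma dappB (c d : dual) x : dapp (c - d) x = dapp c x - dapp d x.
Proof. by rewrite dappD dappN. Qed.

Lemma dual_ext (c d : dual) : (forall x, dapp c x = dapp d x) -> c = d.
Proof. by move=> cd; apply/val_inj/ffunP. Qed.

Lemma mk_dual (f : A -> 'Z_a) : zmod_morphism f -> exists c : dual, dapp c =1 f.
Proof.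
move=> fB; have cP : [ffun x => f x] \in dual_pred.
  by apply/dual_predP => x y; rewrite !ffunE fB.
by exists (Dual cP) => x; rewrite /dapp ffunE.
Qed.

End Dual.
Coercion dapp : dual >-> Funclass.

Lemma unity_root_log (a : nat) (z w : algC) : (1 < a)%N -> a.-primitive_root z ->
  w ^+ a = 1 -> exists k : 'Z_a, w = z ^+ k.
Proof.
move=> a_gt1 z_prim wa; have [i ->] := prim_rootP z_prim wa.
have Ea : (Zp_trunc a).+2 = a by rewrite Zp_cast.
by exists (cast_ord (esym Ea) i).
Qed.

(** The kernels of the linear characters of an abelian group intersect trivially, so some linear
    character is not 1 at x. Its values are a-th roots of unity, and their logarithms to the base of
    a primitive root form the additive character. *)
Lemma dual_sep (a : nat) (A : finZmodType) (x : A) : (0 < a)%N ->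
  (forall y : A, y *+ a = 0) -> x != 0 -> exists c : dual a A, c x != 0.
Proof.
move=> a_gt0 aA x0.
have a_gt1 : (1 < a)%N.
  case: a a_gt0 aA => [|[|a]] // _ aA; by move: x0; rewrite -(mulr1n x) aA eqxx.
have [z z_prim] := C_prim_root_exists a_gt0.
pose gT : finGroupType := A.
have abA : abelian [set: gT].
  by apply/centsP => u _ v _; apply: (addrC u v).
have [i lin_i chix] : exists2 i, 'chi[[set: gT]%G]_i \is a linear_char & 'chi_i (x : gT) != 1.
  have : (x : gT) \notin \bigcap_(i | 'chi[[set: gT]%G]_i \is a linear_char) (cfker 'chi_i).
    by move/derG1P: abA => abA; rewrite cap_cfker_lin_irr abA inE.
  move=> nx; apply/exists_inP; apply: contraNT nx => /exists_inPn h.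
  apply/bigcapP => i lin_i; rewrite cfkerEirr inE (lin_char1 lin_i).
  by have := h i lin_i; rewrite negbK.
have expgE (y : gT) k : (y ^+ k)%g = (y : A) *+ k.
  by elim: k => [|k IHk]; rewrite ?mulr0n ?expg0 // expgS IHk mulrS.
have chiX (y : A) : exists k : 'Z_a, 'chi[[set: gT]%G]_i (y : gT) == z ^+ k.
  have [|k ->] := @unity_root_log _ z ('chi[[set: gT]%G]_i (y : gT)) a_gt1 z_prim.
    by rewrite -(lin_charX lin_i) ?inE // expgE aA (lin_char1 lin_i).
  by exists k.
pose f (y : A) : 'Z_a := xchoose (chiX y).
have fE y : 'chi[[set: gT]%G]_i (y : gT) = z ^+ f y by apply/eqP/(xchooseP (chiX y)).
have fD u v : f (u + v) = f u + f v.
  have z_prim' : (Zp_trunc a).+2.-primitive_root z by rewrite Zp_cast.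
  apply: val_inj => /=; rewrite -[LHS](modn_small (ltn_ord _)); apply/eqP.
  rewrite -(eq_prim_root_expr z_prim') -fE exprD -!fE.
  by rewrite -(lin_charM lin_i) ?inE.
have fB : zmod_morphism f.
  by move=> u v; apply: (addIr (f v)); rewrite -fD !subrK.
have [c cE] := mk_dual fB; exists c; rewrite cE.
by apply: contraNneq chix => fx0; rewrite fE fx0 expr0.
Qed.

Lemma prim_root_exists (C : numClosedFieldType) n :
  (0 < n)%N -> exists z : C, n.-primitive_root z.
Proof.
pose p : {poly C} := 'X^n - 1; have [r Dp] := closed_field_poly_normal p.
move=> n_gt0; rewrite (monicP _) ?monicXnsubC // scale1r in Dp.
have rn1 : all n.-unity_root r by apply/allP => z; rewrite -root_prod_XsubC -Dp.
have sz_r : (n < (size r).+1)%N.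
  by rewrite -(size_prod_XsubC r id) -Dp size_XnsubC.
have [|z] := hasP (has_prim_root n_gt0 rn1 _ sz_r); last by exists z.
by rewrite -separable_prod_XsubC -Dp separable_Xn_sub_1 // pnatr_eq0 -lt0n.
Qed.

(** * Roots of unity and orthogonality of characters *)

Section Omega.
Variables (a : nat) (C : numClosedFieldType) (z : C).
Hypothesis z_prim : (Zp_trunc a).+2.-primitive_root z.

Definition om (x : 'Z_a) : C := z ^+ x.

Lemma om0 : om 0 = 1. Proof. by rewrite /om expr0. Qed.

Lemma omD x y : om (x + y) = om x * om y.
Proof.
rewrite /om -exprD; apply/eqP.
by rewrite (eq_prim_root_expr z_prim) /= modn_mod.
Qed.

Lemma om_sum (I : finType) (P : pred I) (f : I -> 'Z_a) :
  om (\sum_(i | P i) f i) = \prod_(i | P i) om (f i).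
Proof. exact: (big_morph om omD om0). Qed.

Lemma om_norm x : `|om x| = 1.
Proof.
have : `|om x| ^+ (Zp_trunc a).+2 = 1.
  by rewrite -normrX /om -exprM mulnC exprM (prim_expr_order z_prim) expr1n normr1.
by move/eqP; rewrite pexpr_eq1 // => /eqP.
Qed.

Lemma om_inj : injective om.
Proof.
move=> x y /eqP; rewrite (eq_prim_root_expr z_prim) !modn_small ?ltn_ord //.
by move=> /eqP; apply: val_inj.
Qed.

Lemma om_eq1 x : (om x == 1) = (x == 0).
Proof. by rewrite -om0 (inj_eq om_inj). Qed.

(** If f does not vanish at some b0 in L, translation by b0 multiplies the sum by [om (f b0)], which
    is not 1, so the sum is 0. *)
Lemma char_sum (B : finZmodType) (f : B -> 'Z_a) (L : {set B}) :
  zmod_morphism f -> GRing.zmod_closed L ->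
  \sum_(b in L) om (f b) = #|L|%:R * [forall b in L, f b == 0]%:R.
Proof.
move=> fB [L0 LB]; case: (boolP [forall b in L, f b == 0]) => [/forall_inP h|].
  under eq_bigr => b bL do rewrite (eqP (h b bL)) om0.
  by rewrite sumr_const mulr1.
rewrite negb_forall_in => /exists_inP[b0 b0L fb0]; rewrite mulr0.
have fD u v : f (u + v) = f u + f v.
  by apply: (addIr (- f v)); rewrite -fB !addrK.
have LD u v : u \in L -> v \in L -> u + v \in L.
  by move=> uL vL; rewrite -[v]opprK LB // -sub0r LB.
have E : \sum_(b in L) om (f b) = om (f b0) * \sum_(b in L) om (f b).
  rewrite [LHS](reindex_inj (addrI b0)) /= mulr_sumr.
  apply: eq_big => [b|b _]; last by rewrite fD omD.
  apply/idP/idP => bL; last exact: LD.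
  by rewrite -[b](addKr b0) addrC LB.
apply/eqP; have /eqP := E; rewrite -subr_eq0 -{1}[\sum_(b in L) _]mul1r -mulrBl.
by rewrite mulf_eq0 subr_eq0 eq_sym om_eq1 (negPf fb0).
Qed.

(** Both sides evaluate the double sum of [om (e l b)] over L and B, the two orders of summation
    being treated by [char_sum]. *)
Lemma pairing_card (A B : finZmodType) (e : A -> B -> 'Z_a) (L : {set A}) :
  (forall b, zmod_morphism (e^~ b)) -> (forall l, zmod_morphism (e l)) ->
  GRing.zmod_closed L ->
  (#|L| * #|[set b | [forall l in L, e l b == 0%R]]| =
   #|B| * #|[set l in L | [forall b, e l b == 0%R]]|)%N.
Proof.
move=> eA eB LP; apply/eqP; rewrite -(eqr_nat C) !natrM; apply/eqP.
have setTP : GRing.zmod_closed [set: B] by split=> [|u v]; rewrite !inE.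
transitivity (\sum_(l in L) \sum_(b in [set: B]) om (e l b)).
  rewrite exchange_big /=.
  under [RHS]eq_bigr => b _ do rewrite (char_sum (eA b) LP).
  rewrite -mulr_sumr; congr (_ * _); rewrite -sum1_card natr_sum.
  rewrite big_mkcond [RHS]big_mkcond; apply: eq_bigr => b _; rewrite !inE.
  by case: ifP.
under eq_bigr => l _ do rewrite (char_sum (eB l) setTP) cardsT.
rewrite -mulr_sumr; congr (_ * _).
rewrite -sum1_card natr_sum big_mkcond [RHS]big_mkcond; apply: eq_bigr => l _.
rewrite !inE; case: (l \in L) => //=.
have -> : [forall b in [set: B], e l b == 0] = [forall b, e l b == 0].
  by apply: eq_forallb => b; rewrite inE.
by case: [forall b, _].
Qed.

End Omega.

(** * Duality between subgroups and their annihilators *)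

Section Duality.
Variables (a : nat) (A : finZmodType).
Hypotheses (a_gt0 : (0 < a)%N) (aA : forall x : A, x *+ a = 0).
Local Notation dual := (dual a A).

Let zex : exists z : algC, (Zp_trunc a).+2.-primitive_root z :=
  @prim_root_exists algC (Zp_trunc a).+2 isT.

Let dA (x : A) : zmod_morphism (fun c : dual => c x).
Proof. by move=> c d; rewrite dappB. Qed.

Lemma dual_sep0 (x : A) : (forall c : dual, c x = 0) -> x = 0.
Proof.
move=> h; apply/eqP; apply: contraT => x0.
by have [c /negP[]] := dual_sep a_gt0 aA x0; rewrite h.
Qed.

Lemma annihilator_card (L : {set dual}) : GRing.zmod_closed L ->
  (#|L| * #|[set x | [forall c in L, (c : dual) x == 0%R]]| = #|A|)%N.
Proof.
have [z z_prim] := zex => LP; have [L0 _] := LP.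
rewrite (pairing_card z_prim) //; last exact: dapp_zmod_morphism.
rewrite (_ : [set _ in _ | _] = [set 0]) ?cards1 ?muln1 //.
apply/setP => c; rewrite !inE; apply/andP/eqP => [[_ /forallP h]|->].
  by apply: dual_ext => x; rewrite dapp0; apply/eqP.
by split=> //; apply/forallP => x; rewrite dapp0.
Qed.

Lemma preannihilator_card (H : {set A}) : GRing.zmod_closed H ->
  (#|H| * #|[set c : dual | [forall x in H, c x == 0%R]]| = #|{: dual}|)%N.
Proof.
have [z z_prim] := zex => HP; have [H0 _] := HP.
rewrite (pairing_card (e := fun x (c : dual) => c x) z_prim) //; last first.
  exact: dapp_zmod_morphism.
rewrite (_ : [set _ in _ | _] = [set 0]) ?cards1 ?muln1 //.
apply/setP => x; rewrite !inE; apply/andP/eqP => [[_ /forallP h]|->].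
  by apply: dual_sep0 => c; apply/eqP.
by split=> //; apply/forallP => c; rewrite raddf0.
Qed.

Lemma card_dual : #|{: dual}| = #|A|.
Proof.
have TP : GRing.zmod_closed [set: A] by split=> [|u v]; rewrite !inE.
rewrite -(preannihilator_card TP) cardsT -[RHS]muln1; congr (_ * _)%N.
rewrite (_ : [set _ | _] = [set 0]) ?cards1 //; apply/setP => c.
rewrite !inE; apply/forall_inP/eqP => [h|-> x _]; last by rewrite dapp0.
by apply: dual_ext => x; rewrite dapp0; apply/eqP/h.
Qed.

(** The subgroup H spanned by the family has trivial annihilator, hence as many elements as A by
    [preannihilator_card] and [card_dual]. *)
Lemma generatedP (I : finType) (f : I -> A) :
  (forall c : dual, (forall i, c (f i) = 0) -> c = 0) ->
  forall x, exists u : I -> nat, x = \sum_i f i *+ u i.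
Proof.
move=> fgen; have NE (x : A) : - x = x *+ a.-1.
  by apply/eqP; rewrite eq_sym -subr_eq0 opprK -mulrSr prednK // aA.
(* Coefficients are taken modulo a, which makes H the image of a finite type; -1 is represented by a
   - 1. *)
pose H := [set \sum_i f i *+ (u : {ffun I -> 'I_a}) i | u : {ffun I -> 'I_a}].
have red (u : I -> nat) : \sum_i f i *+ u i \in H.
  apply/imsetP; exists [ffun i => Ordinal (ltn_pmod (u i) a_gt0)] => //.
  apply: eq_bigr => i _; rewrite ffunE /= {1}(divn_eq (u i) a) mulrnDr mulnC.
  by rewrite mulrnA aA mul0rn add0r.
have HP : GRing.zmod_closed H.
  split=> [|_ _ /imsetP[u _ ->] /imsetP[v _ ->]].
    by have := red (fun=> 0%N); rewrite big1.
  rewrite -sumrB (eq_bigr (fun i => f i *+ (u i + v i * a.-1))) => [|i _].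
    exact: (red (fun i => (u i + v i * a.-1)%N)).
  by rewrite mulrnDr mulrnA -NE.
have cH : #|H| = #|A|.
  rewrite -card_dual -(preannihilator_card HP) -[LHS]muln1; congr (_ * _)%N.
  rewrite (_ : [set _ | _] = [set 0]) ?cards1 //; apply/setP => c.
  rewrite !inE; apply/forall_inP/eqP => [h|-> x _]; last by rewrite dapp0.
  apply: fgen => i; apply/eqP/h.
  have := red (fun j => (j == i) : nat); rewrite (bigD1 i) //= eqxx mulr1n.
  by rewrite big1 ?addr0 // => j /negPf ->.
move=> x; have /imsetP[u _ ->] : x \in H; last by exists (fun i => u i : nat).
have : H == [set: A] by rewrite eqEcard subsetT cardsT cH leqnn.
by move=> /eqP ->; rewrite inE.
Qed.

End Duality.

(** * Expectation over finitely many independent variables *)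

Section Expectation.
Variables (E V : finType) (C : numFieldType) (m : E -> V -> C).
Hypotheses (m_ge0 : forall e v, 0 <= m e v) (m_sum : forall e, \sum_v m e v = 1).

Definition Ex (f : {ffun E -> V} -> C) : C :=
  \sum_(x : {ffun E -> V}) (\prod_e m e (x e)) * f x.

Definition upd (x : {ffun E -> V}) e v : {ffun E -> V} :=
  [ffun e' => if e' == e then v else x e'].

Definition indep_of (T : Type) (f : {ffun E -> V} -> T) e :=
  forall x v, f (upd x e v) = f x.

Let W_ge0 (x : {ffun E -> V}) : 0 <= \prod_e m e (x e).
Proof. exact: prodr_ge0. Qed.

Lemma eq_Ex f g : f =1 g -> Ex f = Ex g.
Proof. by move=> fg; apply: eq_bigr => x _; rewrite fg. Qed.

Lemma Ex_ge0 f : (forall x, 0 <= f x) -> 0 <= Ex f.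
Proof. by move=> f0; apply: sumr_ge0 => x _; rewrite mulr_ge0. Qed.

Lemma le_Ex f g : (forall x, f x <= g x) -> Ex f <= Ex g.
Proof. by move=> fg; apply: ler_sum => x _; rewrite ler_wpM2l. Qed.

Lemma Ex_norm f : `|Ex f| <= Ex (fun x => `|f x|).
Proof.
apply: le_trans (ler_norm_sum _ _ _) _; apply: ler_sum => x _.
by rewrite normrM ger0_norm.
Qed.

Lemma Ex_sum (I : finType) (P : pred I) (f : I -> {ffun E -> V} -> C) :
  Ex (fun x => \sum_(i | P i) f i x) = \sum_(i | P i) Ex (f i).
Proof.
rewrite /Ex exchange_big /=; apply: eq_bigr => x _.
by rewrite mulr_sumr.
Qed.

Lemma ExZl k f : Ex (fun x => k * f x) = k * Ex f.
Proof. by rewrite mulr_sumr; apply: eq_bigr => x _; rewrite mulrCA. Qed.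

Lemma Ex1 : Ex (fun=> 1) = 1.
Proof.
rewrite /Ex (eq_bigr (fun x : {ffun E -> V} => \prod_e m e (x e))).
  by rewrite -(bigA_distr_bigA m) /=; apply: big1.
by move=> x _; rewrite mulr1.
Qed.

Lemma updK x e v w : upd (upd x e v) e w = upd x e w.
Proof. by apply/ffunP => e'; rewrite !ffunE; case: eqP. Qed.

Lemma upd_id x e : upd x e (x e) = x.
Proof. by apply/ffunP => e'; rewrite ffunE; case: eqP => // ->. Qed.

Lemma upd_eq x e v : upd x e v e = v. Proof. by rewrite ffunE eqxx. Qed.

(** Resampling the coordinate e does not change the law of x: exchanging the old value with the
    fresh one is a weight-preserving involution of the pairs (x, v). *)
Lemma Ex_integrate e f : Ex f = Ex (fun x => \sum_v m e v * f (upd x e v)).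
Proof.
pose W x := \prod_(e' | e' != e) m e' (x e').
have WE (x : {ffun E -> V}) : \prod_e' m e' (x e') = m e (x e) * W x by rewrite (bigD1 e).
have WU x v : W (upd x e v) = W x.
  by apply: eq_bigr => e' /negPf ne; rewrite ffunE ne.
pose h (p : {ffun E -> V} * V) := (upd p.1 e p.2, p.1 e).
have hK : involutive h by move=> [x v]; rewrite /h /= updK upd_id upd_eq.
have -> : Ex (fun x => \sum_v m e v * f (upd x e v)) =
    \sum_(p : {ffun E -> V} * V) m e (p.1 e) * W p.1 * (m e p.2 * f (upd p.1 e p.2)).
  rewrite -(pair_bigA _ (fun (x : {ffun E -> V}) v => m e (x e) * W x * (m e v * f (upd x e v)))) /=.
  by apply: eq_bigr => x _; rewrite WE mulr_sumr.
rewrite (reindex_inj (inv_inj hK)) /=.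
under eq_bigr => p _ do rewrite upd_eq WU updK upd_id.
rewrite -(pair_bigA _ (fun (x : {ffun E -> V}) v => m e v * W x * (m e (x e) * f x))) /=.
apply: eq_bigr => x _; rewrite WE.
rewrite -[LHS]mul1r -(m_sum e) mulr_suml; apply: eq_bigr => v _; ring.
Qed.

Lemma Ex_indep1 e f g : indep_of f e ->
  Ex (fun x => f x * g (x e)) = Ex f * \sum_v m e v * g v.
Proof.
move=> fe; rewrite (Ex_integrate e) mulrC -ExZl; apply: eq_Ex => x.
by rewrite mulr_suml; apply: eq_bigr => v _; rewrite fe upd_eq mulrA mulrAC.
Qed.

Lemma Ex_indep (S : {set E}) f (g : E -> V -> C) :
  (forall e, e \in S -> indep_of f e) ->
  Ex (fun x => f x * \prod_(e in S) g e (x e)) =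
  Ex f * \prod_(e in S) \sum_v m e v * g e v.
Proof.
move=> fS; rewrite -big_enum /=.
under eq_Ex => x do rewrite -big_enum /=.
have := enum_uniq S; have : {subset enum S <= S} by move=> e; rewrite mem_enum.
elim: (enum S) => [_ _|e s IHs sS /= /andP[es s_uniq]].
  by rewrite big_nil mulr1; apply: eq_Ex => x; rewrite big_nil mulr1.
rewrite [in RHS]big_cons mulrCA -IHs //; last first.
  by move=> e' e's; apply: sS; rewrite inE e's orbT.
rewrite mulrC -Ex_indep1; first by apply: eq_Ex => x; rewrite big_cons; ring.
move=> x v; rewrite fS ?sS ?mem_head //; congr (_ * _).
apply: eq_big_seq => e' e's; rewrite ffunE.
by case: eqP es => // <-; rewrite e's.
Qed.

(** Each event j has a private coordinate [ec j] on which no other event depends. Integrating these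
    coordinates one at a time gives a factor beta for each, although the events need not be
    independent. *)
Lemma Ex_prod_le (I : finType) (J : {set I}) (ec : I -> E) (f : I -> {ffun E -> V} -> bool)
    (beta : C) : 0 <= beta ->
  (forall i j, i \in J -> j \in J -> i != j -> indep_of (f i) (ec j)) ->
  (forall j x, j \in J -> \sum_v m (ec j) v * (f j (upd x (ec j) v))%:R <= beta) ->
  Ex (fun x => [forall j in J, f j x]%:R) <= beta ^+ #|J|.
Proof.
move=> b0 fI fb.
have -> : Ex (fun x => [forall j in J, f j x]%:R) = Ex (fun x => \prod_(j <- enum J) (f j x)%:R).
  apply: eq_Ex => x; rewrite big_enum /=; case: (boolP [forall j in J, f j x]).
    by move=> /forall_inP h; rewrite big1 // => j /h ->.
  by rewrite negb_forall_in => /exists_inP[j jJ /negPf fj]; rewrite (bigD1 j) //= fj mul0r.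
rewrite cardE.
have := enum_uniq J; have : {subset enum J <= J} by move=> e; rewrite mem_enum.
elim: (enum J) => [_ _|j s IHs sS /= /andP[js s_uniq]].
  by under eq_Ex => x do rewrite big_nil; rewrite Ex1 expr0.
have jJ : j \in J by rewrite sS ?mem_head.
have sJ : {subset s <= J} by move=> i i_s; rewrite sS // inE i_s orbT.
rewrite exprS (Ex_integrate (ec j)).
apply: le_trans (_ : beta * Ex (fun x => \prod_(j <- s) (f j x)%:R) <= _); last first.
  by rewrite ler_wpM2l ?IHs.
rewrite -ExZl; apply: le_Ex => x.
rewrite (eq_bigr (fun v => (\prod_(j <- s) (f j x)%:R) *
   (m (ec j) v * (f j (upd x (ec j) v))%:R))); last first.
  move=> v _; rewrite big_cons mulrA mulrC; congr (_ * _).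
  apply: eq_big_seq => i i_s; rewrite (fI i j (sJ _ i_s) jJ) //.
  by apply/eqP => ij; move: js; rewrite -ij i_s.
by rewrite -mulr_sumr mulrC ler_wpM2r ?fb // prodr_ge0.
Qed.

End Expectation.

Lemma leq_card_bigcup (I T : finType) (P : pred I) (Q : I -> {set T}) :
  (#|\bigcup_(i | P i) Q i| <= \sum_(i | P i) #|Q i|)%N.
Proof.
elim/big_rec2: _ => [|i y A _ h]; first by rewrite cards0.
by apply: leq_trans (leq_card_setU _ _) _; rewrite leq_add2l.
Qed.

Lemma card_family_prod (I T : finType) (P : I -> {set T}) :
  #|[set f : {ffun I -> T} | [forall i, f i \in P i]]| = (\prod_i #|P i|)%N.
Proof.
transitivity #|family (fun i => mem (P i))|.
  by apply: eq_card => f; rewrite inE; apply/forallP/familyP.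
by rewrite card_family foldrE big_map big_enum.
Qed.

(** * Exponential sums attached to a random symmetric matrix *)

Section SymForm.
(* [ue i j] is the coordinate of a symmetric matrix shared by the positions
   (i, j) and (j, i). *)
Variables (n : nat) (E : finType) (ue : 'I_n -> 'I_n -> E).
Hypotheses (ueC : forall i j, ue i j = ue j i)
  (ue_inj : forall i j k l, ue i j = ue k l -> (i = k /\ j = l) \/ (i = l /\ j = k)).
Variables (a : nat) (G : finZmodType).
Hypotheses (a_gt0 : (0 < a)%N) (aG : forall g : G, g *+ a = 0).
Local Notation dual := (dual a G).

Implicit Types (J : {set 'I_n}) (F : {ffun 'I_n -> G}) (D : {ffun 'I_n -> dual}).

Definition sform J F D (x : {ffun E -> 'Z_a}) : 'Z_a :=
  \sum_(i in J) \sum_(j in J) D j (F i) * x (ue i j).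

Definition inner J : {set E} := [set ue p.1 p.2 | p in setX J J].

Definition coef J F D e : 'Z_a :=
  \sum_(p in setX J J | ue p.1 p.2 == e) D p.2 (F p.1).

Lemma sformE J F D x : sform J F D x = \sum_(e in inner J) coef J F D e * x e.
Proof.
rewrite /sform pair_big_dep /=.
rewrite (eq_bigl (fun p => p \in setX J J)) => [|p]; last by rewrite inE.
rewrite (partition_big (fun p => ue p.1 p.2) (mem (inner J))) /=; last first.
  by move=> p pJ; apply: imset_f.
apply: eq_bigr => e _; rewrite mulr_suml.
by apply: eq_bigr => p /andP[_ /eqP ->].
Qed.

Lemma dual_torsion (c : dual) g : c g *+ a = 0.
Proof. by rewrite -raddfMn /= aG raddf0. Qed.

Lemma coef_torsion J F D e : coef J F D e *+ a = 0.
Proof. by rewrite -sumrMnl big1 // => p _; rewrite dual_torsion. Qed.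

Lemma coef_offdiag J F D i j : i \in J -> j \in J -> i != j ->
  coef J F D (ue i j) = D j (F i) + D i (F j).
Proof.
move=> iJ jJ ij; rewrite /coef (bigD1 (i, j)) /=; last by rewrite inE iJ jJ eqxx.
rewrite (bigD1 (j, i)) /=; last first.
  by rewrite inE jJ iJ ueC eqxx xpair_eqE eq_sym (negPf ij).
rewrite big1 ?addr0 // => -[k l] /= /andP[/andP[/andP[_ /eqP kl] n1] n2].
by case: (ue_inj kl) n1 n2 => -[-> ->]; rewrite eqxx.
Qed.

Definition bad J F D i : {set 'I_n} := [set j in J | D j (F i) + D i (F j) != 0].

(** There are at least 2u * u pairs (i, j) with i among these indices, j bad for i and j != i, and
    every entry of the symmetric matrix comes from at most two pairs. *)
Lemma card_coef_neq0 J F D u :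
  (2 * u <= #|[set i in J | u < #|bad J F D i|]|)%N ->
  (u * u <= #|[set e in inner J | coef J F D e != 0%R]|)%N.
Proof.
set B := [set i in J | _]; set Z := [set e in _ | _] => Bu.
pose Ps := [set p : 'I_n * 'I_n | (p.1 \in B) && (p.2 \in bad J F D p.1 :\ p.1)].
have le1 : (2 * u * u <= #|Ps|)%N.
  apply: leq_trans (_ : #|B| * u <= _)%N; first by rewrite leq_mul2r Bu orbT.
  rewrite -[#|Ps|]sum1_card (eq_bigl (fun p : 'I_n * 'I_n =>
    (p.1 \in B) && (p.2 \in bad J F D p.1 :\ p.1))); last by move=> p; rewrite inE.
  rewrite -(pair_big_dep (mem B) (fun i j => j \in bad J F D i :\ i) (fun _ _ => 1%N)) /=.
  rewrite -sum_nat_const; apply: leq_sum => i; rewrite inE => /andP[_ ui].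
  have -> : (\sum_(j | j \in bad J F D i :\ i) 1 = #|bad J F D i :\ i|)%N by rewrite sum1_card.
  (* Removing i itself costs at most one element, so more than u leaves at least u. *)
  have := cardsD1 i (bad J F D i); lia.
have le2 : (#|Ps| <= 2 * #|Z|)%N.
  rewrite -[#|Ps|]sum1_card (partition_big (fun p => ue p.1 p.2) (mem Z)) /=; last first.
    move=> [i j]; rewrite !inE /= => /andP[/andP[iJ _] /andP[ji /andP[jJ h]]].
    have ij : i != j by rewrite eq_sym.
    rewrite (coef_offdiag F D iJ jJ ij) h andbT; apply/imsetP.
    by exists (i, j) => //; rewrite inE /= iJ.
  rewrite mulnC -sum_nat_const; apply: leq_sum => e; rewrite inE => /andP[/imsetP[[k l] _ /= eE] _].
  rewrite sum1dep_card; apply: leq_trans (_ : #|[set (k, l); (l, k)]| <= 2)%N.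
    apply: subset_leq_card; apply/subsetP => -[i j]; rewrite !inE /= => /andP[_ /eqP].
    by rewrite eE => /ue_inj[[-> ->]|[-> ->]]; rewrite eqxx ?orbT.
  by rewrite cards2; case: eqP.
nia.
Qed.

Variables (C : numClosedFieldType) (z : C).
Hypothesis z_prim : (Zp_trunc a).+2.-primitive_root z.
Local Notation om := (om z).
Variable m : E -> 'Z_a -> C.
Hypotheses (m_ge0 : forall e v, 0 <= m e v) (m_sum : forall e, \sum_v m e v = 1).
Local Notation Ex := (Ex m).

Variable kap : C.
Hypotheses (kap_ge0 : 0 <= kap) (kap_le1 : kap <= 1).
Hypothesis kapP : forall e (y : 'Z_a), y != 0 -> y *+ a = 0 ->
  `|\sum_v m e v * om (y * v)| <= kap.

Lemma norm_phase_le1 e y : `|\sum_v m e v * om (y * v)| <= 1.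
Proof.
apply: le_trans (ler_norm_sum _ _ _) _; rewrite -(m_sum e) ler_sum // => v _.
by rewrite normrM (om_norm z_prim) mulr1 ger0_norm.
Qed.

(** As f does not depend on the entries of [inner J], the expectation factors; each nonzero
    coefficient contributes at most kap and every other one at most 1. *)
Lemma Ex_om_sform J F D f k : (forall e, e \in inner J -> indep_of f e) ->
  (k <= #|[set e in inner J | coef J F D e != 0%R]|)%N ->
  `|Ex (fun x => f x * om (sform J F D x))| <= Ex (fun x => `|f x|) * kap ^+ k.
Proof.
move=> fI kZ.
under eq_Ex => x do rewrite sformE (om_sum z_prim).
rewrite (@Ex_indep _ _ _ _ m_sum (inner J) f (fun e v => om (coef J F D e * v))) //.
rewrite normrM ler_pM ?normr_ge0 ?Ex_norm //.
rewrite normr_prod (bigID (fun e => coef J F D e != 0)) /= mulrC.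
apply: le_trans (_ : 1 * kap ^+ #|[set e in inner J | coef J F D e != 0]| <= _); last first.
  by rewrite mul1r ler_wiXn2l.
rewrite ler_pM ?prodr_ge0 //.
  by apply: prodr_ile1 => e _; rewrite normr_ge0 norm_phase_le1.
rewrite -prodr_const (eq_bigl (mem [set e in inner J | coef J F D e != 0])); last first.
  by move=> e; rewrite !inE.
apply: ler_prod => e /=; rewrite inE => /andP[_ ce].
by rewrite normr_ge0 kapP // coef_torsion.
Qed.

Variable beta : C.
Hypothesis beta_ge0 : 0 <= beta.
Hypothesis betaP : forall e (y b : 'Z_a), y != 0 -> y *+ a = 0 ->
  \sum_v m e v * (y * v + b == 0)%:R <= beta.

(** If v is nonzero at i0, then i0 lies in s, and the entry (i0, j) occurs in the equation of column
    j and of no other column outside s. If v = 0, the diagonal entry (j, j) plays this role.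
    [Ex_prod_le] then gives a factor beta for each column. *)
Lemma Ex_columns_le (v : 'I_n -> 'Z_a) (q : 'Z_a) (s : {set 'I_n}) :
  (forall i, v i *+ a = 0) -> q *+ a = 0 -> (forall i, i \notin s -> v i = 0) ->
  ((exists i, v i != 0) \/ (forall i, v i = 0) /\ q != 0) ->
  Ex (fun x => [forall j in ~: s, q * x (ue j j) + \sum_i v i * x (ue i j) == 0]%:R)
    <= beta ^+ (n - #|s|).
Proof.
move=> va qa vs vq; have -> : (n - #|s| = #|~: s|)%N by rewrite [RHS]cardsCs setCK card_ord.
case: vq => [[i0 vi0]|[v0 q0]].
  have i0s : i0 \in s by apply: contraNT vi0 => /vs ->.
  apply: (@Ex_prod_le _ _ _ _ m_ge0 m_sum _ (~: s) (ue i0)) => //.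
    move=> i j; rewrite !inE => is_ js ij x t; rewrite ffunE ifN; last first.
      by apply/eqP => /ue_inj[[_ jj]|[jj _]]; rewrite jj eqxx in ij.
    congr (_ + _ == 0); apply: eq_bigr => k _; rewrite ffunE.
    case: eqP => // /ue_inj[] [kk jj]; first by rewrite jj eqxx in ij.
    by move: is_; rewrite jj i0s.
  move=> j x; rewrite inE => js.
  apply: le_trans (betaP (ue i0 j)
    (q * x (ue j j) + \sum_(i | i != i0) v i * x (ue i j)) vi0 (va i0)).
  apply: ler_sum => t _; rewrite (_ : _ == 0 = (v i0 * t + (q * x (ue j j) +
     \sum_(i | i != i0) v i * x (ue i j)) == 0)) //.
  rewrite (bigD1 i0) //= !ffunE eqxx ifN; last first.
    by apply/eqP => /ue_inj[[jj _]|[_ jj]]; move: js; rewrite jj i0s.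
  rewrite addrCA; congr (_ + (_ + _) == 0); apply: eq_bigr => i ii0; rewrite ffunE.
  case: eqP => // /ue_inj[] [kk jj]; first by rewrite kk eqxx in ii0.
  by move: js; rewrite jj i0s.
apply: (@Ex_prod_le _ _ _ _ m_ge0 m_sum _ (~: s) (fun j => ue j j)) => //.
  move=> i j _ _ ij x t; rewrite !big1 => [|k _|k _]; rewrite ?v0 ?mul0r //.
  rewrite ffunE ifN //.
  by apply/eqP => /ue_inj[[kk _]|[kk _]]; rewrite kk eqxx in ij.
move=> j x _; apply: le_trans (betaP (ue j j) 0 q0 qa).
apply: ler_sum => t _; rewrite big1 => [|k _]; last by rewrite v0 mul0r.
by rewrite upd_eq.
Qed.

Lemma char_sum_prod (I : finType) (B : finZmodType) (f : I -> B -> 'Z_a) :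
  (forall i, zmod_morphism (f i)) ->
  \sum_(b : {ffun I -> B}) om (\sum_i f i (b i)) =
  #|B|%:R ^+ #|I| * [forall i, forall x, f i x == 0]%:R.
Proof.
move=> fB.
under eq_bigr => b _ do rewrite (om_sum z_prim).
rewrite -(bigA_distr_bigA (fun i b => om (f i b))) /=.
have TP : GRing.zmod_closed [set: B] by split=> [|u v]; rewrite !inE.
have E1 i : \sum_b om (f i b) = #|B|%:R * [forall x, f i x == 0]%:R.
  have := char_sum z_prim (fB i) TP; rewrite cardsT.
  under eq_bigl => b do rewrite inE.
  by move=> ->; congr (_ * (nat_of_bool _)%:R); apply: eq_forallb => x; rewrite inE.
under eq_bigr => i _ do rewrite E1.
rewrite big_split /= prodr_const; congr (_ * _).
case: (boolP [forall i, forall x, f i x == 0]) => [/forallP h|].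
  by rewrite big1 // => i _; rewrite h.
by rewrite negb_forall => /existsP[i /negPf fi]; rewrite (bigD1 i) //= fi mul0r.
Qed.

Definition colsum F (x : {ffun E -> 'Z_a}) j : G := \sum_i F i *+ x (ue i j).

Lemma dual_mulrn (c : dual) g (t : 'Z_a) : c (g *+ t) = c g * t.
Proof. by rewrite raddfMn /= -mulr_natr natr_Zp. Qed.

(** D ranges over all n coordinates even though only those in J are tested, hence the exponent n. *)
Lemma fourier_indicator J (g : 'I_n -> G) :
  \sum_(D : {ffun 'I_n -> dual}) om (\sum_(j in J) D j (g j)) =
  #|G|%:R ^+ n * [forall j in J, g j == 0]%:R.
Proof.
pose f j (c : dual) : 'Z_a := if j \in J then c (g j) else 0.
have fB j : zmod_morphism (f j).
  by move=> c d; rewrite /f; case: ifP; rewrite ?subr0 // dappB.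
under eq_bigr => D _ do rewrite big_mkcond /=.
rewrite (char_sum_prod fB) card_ord card_dual //; congr (_ * (nat_of_bool _)%:R).
apply/eq_forallb => j; rewrite /f; case: (j \in J) => /=; last first.
  by apply/forallP.
apply/forallP/eqP => [h|-> c]; last by rewrite raddf0.
by apply: (dual_sep0 a_gt0 aG) => c; apply/eqP.
Qed.

Definition annih J F : {set dual} := [set c : dual | [forall j in J, c (F j) == 0]].

(** Hamming weight on J of the word formed by the values c (F_j). *)
Definition weight J F (c : dual) : nat := #|[set j in J | c (F j) != 0]|.

Definition badset J F D u : {set 'I_n} := [set i in J | (u < #|bad J F D i|)%N].

Lemma annihP J F (c : dual) : reflect (forall j, j \in J -> c (F j) = 0) (c \in annih J F).
Proof.
rewrite inE; apply: (iffP forall_inP) => h j jJ; first by apply/eqP/h.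
by rewrite h.
Qed.

Lemma annih_closed J F : GRing.zmod_closed (annih J F).
Proof.
split=> [|c d /annihP hc /annihP hd]; first by apply/annihP => j _; rewrite dapp0.
by apply/annihP => j jJ; rewrite dappB hc ?hd ?subr0.
Qed.

(* Two indices with equal columns and few bad partners carry characters whose
   difference has small weight, hence lies in [annih]. *)
Lemma almost_function J F D u : (forall c : dual, (weight J F c <= 2 * u)%N -> c \in annih J F) ->
  exists r : {ffun G -> dual}, forall i, i \in J :\: badset J F D u -> D i - r (F i) \in annih J F.
Proof.
move=> code.
pose r := [ffun g => if [pick i in J :\: badset J F D u | F i == g] is Some i then D i else 0].
exists r => i; rewrite ffunE => iJ.
case: pickP => [k /andP[]|/(_ i)]; last by rewrite iJ eqxx.
have nbad l : l \in J :\: badset J F D u -> (#|bad J F D l| <= u)%N.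
  by rewrite !inE => /andP[h lJ]; move: h; rewrite lJ /= -leqNgt.
move=> kJ /eqP FkFi; apply: code.
apply: leq_trans (_ : #|bad J F D i :|: bad J F D k| <= _)%N; last first.
  by apply: leq_trans (leq_card_setU _ _) _; rewrite mul2n -addnn leq_add ?nbad.
apply/subset_leq_card/subsetP => j; rewrite !inE => /andP[jJ]; rewrite jJ /=.
apply: contraNT; rewrite negb_or !negbK dappB => /andP[/eqP h1 /eqP h2].
apply/eqP; rewrite -(subrr (0 : 'Z_a)) -{1}h1 -h2 FkFi; ring.
Qed.

Definition nsub b : nat := #|[set B : {set 'I_n} | (#|B| <= b)%N]|.

Lemma nsub_sum (T : finType) b (Q : {set 'I_n} -> {set T}) k :
  (forall B : {set 'I_n}, #|B| <= b -> #|Q B| <= k)%N ->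
  (#|[set t | [exists B : {set 'I_n}, (#|B| <= b)%N && (t \in Q B)]]| <= nsub b * k)%N.
Proof.
move=> Qk; rewrite -sum_nat_const.
apply: leq_trans (_ : \sum_(B in [set B : {set 'I_n} | (#|B| <= b)%N]) #|Q B| <= _)%N; last first.
  by apply: leq_sum => B; rewrite inE; apply: Qk.
apply: leq_trans (leq_card_bigcup _ _).
apply/subset_leq_card/subsetP => t; rewrite inE => /existsP[B /andP[Bb tB]].
by apply/bigcupP; exists B => //; rewrite inE.
Qed.

Lemma prod_if_card (A : {set 'I_n}) (p q : nat) :
  (\prod_i (if i \in A then p else q) = p ^ #|A| * q ^ #|~: A|)%N.
Proof.
rewrite (bigID (mem A)) /=; congr (_ * _)%N.
  by rewrite (eq_bigr (fun=> p)) ?prod_nat_const // => i ->.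
rewrite (eq_bigr (fun=> q)) => [|i /negPf -> //].
by rewrite -prod_nat_const; apply: eq_bigl => i; rewrite inE.
Qed.

Lemma card_coset_le (L : {set dual}) (d : dual) : (#|[set c : dual | (c - d)%R \in L]| <= #|L|)%N.
Proof.
rewrite -(card_imset _ (@addIr _ (- d))); apply/subset_leq_card/subsetP => e.
by move=> /imsetP[c]; rewrite inE => h ->.
Qed.

(** By [almost_function], D is given by its bad set B, a function r on G, free values outside J
    minus B, and at each remaining index an element of a coset of [annih J F]. The factors count
    these choices in turn. *)
Lemma card_few_bad J F u : (forall c : dual, (weight J F c <= 2 * u)%N -> c \in annih J F) ->
  (#|[set D | (#|badset J F D u| < 2 * u)%N]| <=
   nsub (2 * u) * (#|G| ^ #|G| * (#|G| ^ (n - #|J| + 2 * u) * #|annih J F| ^ #|J|)))%N.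
Proof.
move=> code; set L := annih J F; have [L0 _] := annih_closed J F.
have G_gt0 : (0 < #|G|)%N by apply/card_gt0P; exists 0.
have L_gt0 : (0 < #|L|)%N by apply/card_gt0P; exists 0.
pose Q (B : {set 'I_n}) := \bigcup_(r : {ffun G -> dual})
  [set D : {ffun 'I_n -> dual} |
    [forall i, D i \in (if i \in J :\: B then [set c : dual | c - r (F i) \in L] else setT)]].
set K := (#|G| ^ #|G| * _)%N.
suff QK (B : {set 'I_n}) : (#|B| <= 2 * u)%N -> (#|Q B| <= K)%N.
  apply: leq_trans (nsub_sum QK).
  apply/subset_leq_card/subsetP => D; rewrite !inE => Db.
  apply/existsP; exists (badset J F D u); rewrite (ltnW Db) /=.
  have [r rP] := almost_function D code; apply/bigcupP; exists r => //.
  rewrite inE; apply/forallP => i; by case: ifP => [/rP h|_]; rewrite inE.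
move=> Bb; apply: leq_trans (leq_card_bigcup _ _) _.
have cGd : #|{ffun G -> dual}| = (#|G| ^ #|G|)%N.
  by rewrite card_ffun card_dual.
rewrite /K -cGd -sum_nat_const leq_sum // => r _.
rewrite card_family_prod.
apply: leq_trans (_ : \prod_i (if i \in J :\: B then #|L| else #|G|) <= _)%N.
  apply: leq_prod => i _; case: ifP => _; first exact: card_coset_le.
  by rewrite cardsT card_dual.
rewrite prod_if_card mulnC leq_mul //; last first.
  by rewrite leq_pexp2l // subset_leq_card ?subsetDl.
rewrite leq_pexp2l // setDE setCI setCK.
apply: leq_trans (leq_card_setU _ _) _.
by rewrite cardsCs setCK card_ord leq_add.
Qed.

Definition in_left_kernel F (x : {ffun E -> 'Z_a}) : bool := [forall j, colsum F x j == 0].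

Lemma G_gt0 : 0 < #|G|%:R :> C.
Proof. by rewrite ltr0n; apply/card_gt0P; exists 0. Qed.

Lemma kap_exp_ge0 k : 0 <= kap ^+ k. Proof. exact: exprn_ge0. Qed.

Lemma innerP J e : reflect (exists i j, [/\ i \in J, j \in J & e = ue i j]) (e \in inner J).
Proof.
apply: (iffP imsetP) => [[[i j]]|[i [j [iJ jJ ->]]]].
  by rewrite inE => /andP[iJ jJ] ->; exists i, j.
by exists (i, j) => //; rewrite inE iJ.
Qed.

(* Off the small index set [s], the columns of [F] satisfy a relation [chi],
   which is tested against the entries in [s] alone and costs the factor
   [beta ^+ (n - #|s|)]; the remaining entries then equidistribute the columns
   in the subgroup annihilated by [annih]. *)
Lemma Ex_left_kernel_noncode F u (s : {set 'I_n}) (chi : dual) :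
  chi \in annih (~: s) F -> (exists i, chi (F i) != 0) ->
  (forall c : dual, (weight (~: s) F c <= 2 * u)%N -> c \in annih (~: s) F) ->
  #|G|%:R ^+ n * Ex (fun x => (in_left_kernel F x)%:R) <= beta ^+ (n - #|s|) *
    (#|[set D | (#|badset (~: s) F D u| < 2 * u)%N]|%:R + #|G|%:R ^+ n * kap ^+ (u * u)).
Proof.
move=> /annihP chi0 chi1 code; set J := ~: s in chi0 code *.
(* The vanishing first term puts the relation in the shape of [Ex_columns_le], with q = 0. *)
pose A (x : {ffun E -> 'Z_a}) := [forall j in J, 0 * x (ue j j) + \sum_i chi (F i) * x (ue i j) == 0].
pose g (x : {ffun E -> 'Z_a}) j : G := \sum_(i in s) F i *+ x (ue i j).
have gJ x j : colsum F x j = g x j + \sum_(i in J) F i *+ x (ue i j).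
  rewrite /colsum (bigID (mem s)) /=; congr (_ + _).
  by apply: eq_bigl => i; rewrite inE.
have AP : Ex (fun x => (A x)%:R) <= beta ^+ (n - #|s|).
  apply: Ex_columns_le => [i||i is_|]; rewrite ?dual_torsion ?mul0rn //; last by left.
  by rewrite chi0 // inE.
have AI e : e \in inner J -> indep_of A e.
  move=> /innerP[k [l [kJ lJ ->]]] x t; apply: eq_forallb => j.
  case: (boolP (j \in J)) => //= jJ; rewrite !mul0r.
  congr (_ + _ == 0); apply: eq_bigr => i _; rewrite ffunE; case: eqP => // /ue_inj ij.
  by rewrite chi0 ?mul0r //; case: ij => -[-> _].
have gI e j : e \in inner J -> j \in J -> indep_of (g^~ j) e.
  move=> /innerP[k [l [kJ lJ ->]]] jJ x t; apply: eq_bigr => i is_.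
  rewrite ffunE; case: eqP => // /ue_inj ij; case: ij is_ => -[-> _].
    by move: kJ; rewrite inE => /negPf ->.
  by move: lJ; rewrite inE => /negPf ->.
(* The part of the exponent coming from rows in s does not depend on the entries of [inner J]. It
   joins the indicator A in the weight f, and [Ex_om_sform] treats the rest. *)
pose f (D : {ffun 'I_n -> dual}) x : C := (A x)%:R * om (\sum_(j in J) D j (g x j)).
have fI D e : e \in inner J -> indep_of (f D) e.
  move=> eJ x t; rewrite /f AI //; congr (_ * om _).
  by apply: eq_bigr => j jJ; rewrite [g _ j]gI.
have le1 : #|G|%:R ^+ n * Ex (fun x => (in_left_kernel F x)%:R) <=
    Ex (fun x => (A x)%:R * (#|G|%:R ^+ n * [forall j in J, colsum F x j == 0]%:R)).
  rewrite -ExZl; apply: le_Ex => // x; rewrite mulrCA ler_wpM2l ?exprn_ge0 //.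
  case: (boolP (in_left_kernel F x)) => [/forallP kx|_]; last by rewrite mulr_ge0.
  have -> : A x.
    apply/forall_inP => j _; rewrite mul0r add0r.
    rewrite (eq_bigr (fun i => chi (F i *+ x (ue i j)))) => [|i _]; last by rewrite dual_mulrn.
    by rewrite -raddf_sum /= -[\sum_i _]/(colsum F x j) (eqP (kx j)) raddf0.
  by have -> : [forall j in J, colsum F x j == 0]; rewrite ?mul1r //; apply/forall_inP.
apply: le_trans le1 _; rewrite -[leLHS]ger0_norm; last first.
  by apply: Ex_ge0 => // x; rewrite !mulr_ge0 ?exprn_ge0.
have -> : Ex (fun x => (A x)%:R * (#|G|%:R ^+ n * [forall j in J, colsum F x j == 0]%:R)) =
    \sum_(D : {ffun 'I_n -> dual}) Ex (fun x => f D x * om (sform J F D x)).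
  rewrite -Ex_sum; apply: eq_Ex => x; rewrite -fourier_indicator mulr_sumr.
  apply: eq_bigr => D _; rewrite /f -mulrA -(omD z_prim); congr (_ * om _).
  rewrite /sform exchange_big /= -big_split /=; apply: eq_bigr => j _.
  rewrite gJ raddfD /=; congr (_ + _).
  by rewrite raddf_sum /=; apply: eq_bigr => i _; rewrite dual_mulrn.
apply: le_trans (_ : \sum_D beta ^+ (n - #|s|) *
   ((#|badset J F D u| < 2 * u)%N%:R + kap ^+ (u * u)) <= _); last first.
  rewrite -mulr_sumr big_split /= -natr_sum sumr_const card_ffun card_ord card_dual //.
  rewrite -natrX -[_ *+ (_ ^ _)]mulr_natl ler_wpM2l ?exprn_ge0 // lerD2r ler_nat.
  rewrite -sum1dep_card [leqRHS]big_mkcond /=; apply: leq_sum => D _.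
  by case: ifP.
apply: le_trans (ler_norm_sum _ _ _) _.
apply: ler_sum => D _.
have fA : Ex (fun x => `|f D x|) <= beta ^+ (n - #|s|).
  apply: le_trans AP; apply: le_Ex => // x.
  by rewrite normrM (om_norm z_prim) mulr1 ger0_norm.
have fA0 : 0 <= Ex (fun x => `|f D x|) by apply: Ex_ge0.
case: ltnP => Bu.
  apply: le_trans (Ex_om_sform (k := 0) _ _) _ => //; first by move=> e; apply: fI.
  by rewrite ler_pM ?exprn_ge0 // expr0 lerDl exprn_ge0.
apply: le_trans (Ex_om_sform (k := u * u) _ _) _ => //; first by move=> e; apply: fI.
  exact: card_coef_neq0.
by rewrite add0r ler_pM ?exprn_ge0.
Qed.

(** * Codes, and the contribution of families that are not codes *)

Definition generates F : bool := [forall c : dual, (c \in annih setT F) ==> (c == 0)].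

(** The words (c (F_j)), for c a character, form an additive code; the condition says that c is
    determined by its word and that the minimum distance exceeds d. *)
Definition is_code F d : bool := [forall c : dual, (c != 0) ==> (d < weight setT F c)%N].

Lemma annih_mono J1 J2 F : J1 \subset J2 -> annih J2 F \subset annih J1 F.
Proof.
move=> J12; apply/subsetP => c /annihP h; apply/annihP => j jJ.
exact/h/(subsetP J12).
Qed.

(* As long as some character outside [annih] has small weight, move its support
   into [s]: [annih] grows strictly, so at most #|G| moves are made. *)
Lemma robust_part F d (s : {set 'I_n}) k : (#|G| - #|annih (~: s) F| <= k)%N ->
  exists2 s' : {set 'I_n}, s \subset s' & (#|s'| <= #|s| + k * d)%N /\
    forall c : dual, (weight (~: s') F c <= d)%N -> c \in annih (~: s') F.
Proof.
elim: k s => [|k IHk] s.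
  rewrite leqn0 subn_eq0 -(card_dual a_gt0 aG) => h; exists s => //.
  rewrite mul0n addn0; split=> // c _.
  suff -> : annih (~: s) F = setT by rewrite inE.
  by apply/eqP; rewrite eqEcard subsetT cardsT.
move=> sk; have [/forall_inP h|] := boolP [forall (c : dual | (weight (~: s) F c <= d)%N), c \in annih (~: s) F].
  by exists s => //; split=> //; apply: leq_addr.
rewrite negb_forall_in => /exists_inP[c cd ck].
pose s1 := s :|: [set j in ~: s | c (F j) != 0].
have ss1 : s \subset s1 by apply: subsetUl.
have s1d : (#|s1| <= #|s| + d)%N.
  by apply: leq_trans (leq_card_setU _ _) _; rewrite leq_add2l.
have ck1 : c \in annih (~: s1) F.
  by apply/annihP => j; rewrite !inE negb_or negb_and !negbK => /andP[/negPf ->] /= /eqP.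
have [|s' s1s' [s'd s'P]] := IHk s1.
  have : (#|annih (~: s) F| < #|annih (~: s1) F|)%N.
    apply/proper_card/properP; split; first by rewrite annih_mono // setCS.
    by exists c.
  by move: sk; lia.
by exists s'; [apply: subset_trans ss1 s1s'|split=> //; apply: leq_trans s'd _; lia].
Qed.

(** Start from the support s0 of a nonzero character of weight at most d. This character lies in
    [annih (~: s0) F], so [robust_part] makes at most #|G| - 1 further moves of at most d indices
    each. *)
Lemma noncode_part F d : ~~ is_code F d -> exists s : {set 'I_n}, [/\ (#|s| <= #|G| * d)%N,
    exists2 chi : dual, chi != 0 & chi \in annih (~: s) F &
    forall c : dual, (weight (~: s) F c <= d)%N -> c \in annih (~: s) F].
Proof.
rewrite negb_forall => /existsP[chi]; rewrite negb_imply -leqNgt => /andP[chi0 chid].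
pose s0 := [set j in setT | chi (F j) != 0].
have chik : chi \in annih (~: s0) F.
  by apply/annihP => j; rewrite !inE negbK => /eqP.
have G_gt0 : (0 < #|G|)%N by apply/card_gt0P; exists 0.
have k_gt0 : (0 < #|annih (~: s0) F|)%N by apply/card_gt0P; exists chi.
have [|s s0s [sd sP]] := @robust_part F d s0 #|G|.-1; first by rewrite -subn1 leq_sub2l.
exists s; split=> //; first apply: leq_trans sd _.
  by rewrite -[X in (_ <= X * d)%N](prednK G_gt0) mulSn leq_add2r.
by exists chi => //; apply: subsetP chik; rewrite annih_mono // setCS.
Qed.

(** Group the F by L = [annih (~: s) F]. Off s such an F takes values in the subgroup Lp killed by
    L, and #|L| * #|Lp| = #|G|, so each of the 2 ^ #|G| possible L contributes at most #|G| ^ n. *)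
Lemma sum_annih_card (s : {set 'I_n}) :
  (\sum_F #|annih (~: s) F| ^ (n - #|s|) <= 2 ^ #|G| * #|G| ^ n)%N.
Proof.
rewrite (partition_big (fun F => annih (~: s) F) predT) //=.
have <- : (#|{set dual}| = 2 ^ #|G|)%N.
  transitivity #|powerset [set: dual]|; first by rewrite powersetT cardsT.
  by rewrite card_powerset cardsT card_dual.
rewrite -sum_nat_const; apply: leq_sum => L _.
have [F0 /eqP F0L|noF] := pickP (fun F => annih (~: s) F == L); last first.
  by rewrite big_pred0.
have Lcl : GRing.zmod_closed L by rewrite -F0L; apply: annih_closed.
set Lp := [set g | [forall c in L, (c : dual) g == 0]].
have LLp : (#|L| * #|Lp| = #|G|)%N by apply: annihilator_card.
rewrite (eq_bigr (fun=> (#|L| ^ #|~: s|)%N)) => [|F /eqP ->]; last first.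
  by rewrite [#|~: s|]cardsCs setCK card_ord.
rewrite sum_nat_const.
apply: leq_trans (_ : (#|G| ^ #|s| * #|Lp| ^ #|~: s|) * #|L| ^ #|~: s| <= _)%N.
  rewrite leq_mul2r -prod_if_card; apply/orP; right.
  have -> : (\prod_i (if i \in s then #|G| else #|Lp|) =
      \prod_i #|if i \in s then [set: G] else Lp|)%N.
    by apply: eq_bigr => i _; case: ifP; rewrite ?cardsT.
  rewrite -card_family_prod -[X in (X <= _)%N]cardsE.
  apply/subset_leq_card/subsetP => F.
  rewrite !inE => FL'; have {FL'} FL : annih (~: s) F = L by apply/eqP; exact: FL'.
  apply/forallP => i; case: ifP => is_; rewrite inE //.
  by apply/forall_inP => c; rewrite -FL => /annihP/(_ i); rewrite inE is_ => ->.
rewrite -mulnA -expnMn mulnC [(#|Lp| * _)%N]mulnC LLp -expnD.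
by rewrite addnC cardsC card_ord.
Qed.

(** Union bound over the exceptional set s of [noncode_part]. The count in [card_few_bad] carries a
    power of #|annih|; summed over F by [sum_annih_card] it becomes #|G| ^ n, which cancels the
    Fourier normalisation. *)
Lemma noncode_sum d u : beta <= 1 -> (2 * u <= d)%N ->
  \sum_(F | generates F && ~~ is_code F d) Ex (fun x => (in_left_kernel F x)%:R) <=
  (nsub (#|G| * d))%:R * beta ^+ (n - #|G| * d) *
  ((nsub (2 * u) * (2 ^ #|G| * #|G| ^ (#|G| + (#|G| * d + 2 * u))))%:R +
    #|G|%:R ^+ n * kap ^+ (u * u)).
Proof.
move=> beta_le1 ud; set Nd := (#|G| * d)%N.
rewrite -(ler_pM2l (exprn_gt0 n G_gt0)) mulr_sumr.
pose bnd (s : {set 'I_n}) F : C := beta ^+ (n - Nd) *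
  ((nsub (2 * u) * #|G| ^ (#|G| + (Nd + 2 * u)) * #|annih (~: s) F| ^ (n - #|s|))%:R +
   #|G|%:R ^+ n * kap ^+ (u * u)).
have bnd_ge0 s F : 0 <= bnd s F.
  by rewrite mulr_ge0 ?addr_ge0 ?mulr_ge0 ?exprn_ge0.
have GN : (0 < #|G|)%N by apply/card_gt0P; exists 0.
have le1 F : generates F -> ~~ is_code F d -> #|G|%:R ^+ n * Ex (fun x => (in_left_kernel F x)%:R) <=
    \sum_(s in [set s : {set 'I_n} | (#|s| <= Nd)%N]) bnd s F.
  move=> /forallP Fgen /noncode_part[s [sd [chi chi0 chik] sP]].
  rewrite (bigD1 s) ?inE //=; apply: ler_wpDr; first exact: sumr_ge0.
  have chi1 : exists i, chi (F i) != 0.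
    apply/existsP; apply: contraNT chi0 => /existsPn h.
    apply: (implyP (Fgen chi)); apply/annihP => j _; apply/eqP.
    by have := h j; rewrite negbK.
  have sP' (c : dual) : (weight (~: s) F c <= 2 * u)%N -> c \in annih (~: s) F.
    by move=> h; apply/sP/(leq_trans h).
  apply: le_trans (Ex_left_kernel_noncode chik chi1 sP') _.
  apply: ler_pM; rewrite ?addr_ge0 ?mulr_ge0 ?exprn_ge0 //.
    by rewrite ler_wiXn2l // leq_sub2l.
  rewrite lerD2r ler_nat; apply: leq_trans (card_few_bad sP') _.
  rewrite -mulnA leq_mul // [#|~: s|]cardsCs setCK card_ord mulnA leq_mul //.
  rewrite -expnD leq_pexp2l // leq_add2l leq_add2r; lia.
apply: le_trans (_ : \sum_F \sum_(s in [set s : {set 'I_n} | (#|s| <= Nd)%N]) bnd s F <= _).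
  rewrite big_mkcond /=; apply: ler_sum => F _; case: ifP => [/andP[]|_]; first exact: le1.
  exact: sumr_ge0.
rewrite exchange_big /=.
apply: le_trans (_ : \sum_(s in [set s : {set 'I_n} | (#|s| <= Nd)%N])
  beta ^+ (n - Nd) * (#|G|%:R ^+ n * ((nsub (2 * u) * (2 ^ #|G| * #|G| ^ (#|G| + (Nd + 2 * u))))%:R +
    #|G|%:R ^+ n * kap ^+ (u * u))) <= _); last first.
  by rewrite sumr_const -mulr_natl le_eqVlt; apply/orP; left; apply/eqP; rewrite /nsub; ring.
apply: ler_sum => s _; rewrite -mulr_sumr ler_wpM2l ?exprn_ge0 //.
rewrite big_split /= mulrDr lerD //; last first.
  by rewrite sumr_const card_ffun card_ord -[_ *+ (_ ^ _)]mulr_natl natrX.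
rewrite -natr_sum -natrX -natrM ler_nat -big_distrr /=.
apply: leq_trans (leq_mul (leqnn _) (sum_annih_card s)) _.
by apply/eq_leq; ring.
Qed.

(** Translation by an element outside the kernel maps the kernel injectively into its complement. *)
Lemma card_dual_ker (chi : dual) : chi != 0 -> (2 * #|[set g | chi g == 0%R]| <= #|G|)%N.
Proof.
move=> chi0; have [g0 chig0] : exists g, chi g != 0.
  apply/existsP; apply: contraNT chi0 => /existsPn h; apply/eqP/dual_ext => g.
  by rewrite dapp0; apply/eqP; have := h g; rewrite negbK.
set K := [set g | _]; rewrite -(cardsC K) mul2n -addnn leq_add2l.
rewrite -(card_imset (mem K) (addIr g0)); apply/subset_leq_card/subsetP => h.
move=> /imsetP[g gK ->]; rewrite !inE raddfD /=.
by have := gK; rewrite inE => /eqP ->; rewrite add0r.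
Qed.

(** Off a set of at most d indices, a non-code takes its values in the kernel of a nonzero
    character, which has index at least 2. The bound sums over the character and the index set. *)
Lemma card_noncode d :
  (#|[set F | ~~ is_code F d]| * 2 ^ (n - d) <= #|G| * nsub d * #|G| ^ n)%N.
Proof.
have GN : (0 < #|G|)%N by apply/card_gt0P; exists 0.
pose Q (chi : dual) (s : {set 'I_n}) := [set F : {ffun 'I_n -> G} |
  [forall i, F i \in if i \in s then setT else [set g | chi g == 0]]].
pose M (chi : dual) := [set F | [exists s : {set 'I_n}, (#|s| <= d)%N && (F \in Q chi s)]].
have le1 : (#|[set F | ~~ is_code F d]| <= \sum_(chi | chi != 0%R) #|M chi|)%N.
  apply: leq_trans (leq_card_bigcup _ _); apply/subset_leq_card/subsetP => F.
  rewrite inE negb_forall => /existsP[chi]; rewrite negb_imply -leqNgt => /andP[chi0 chid].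
  apply/bigcupP; exists chi => //; rewrite inE; apply/existsP.
  exists [set j in setT | chi (F j) != 0]; rewrite chid inE /=.
  apply/forallP => i; rewrite inE; case: ifP; rewrite !inE //= => /negbFE.
  by [].
apply: leq_trans (leq_mul le1 (leqnn _)) _.
rewrite -mulnA -{1}(card_dual a_gt0 aG) -sum_nat_const big_distrl /= big_mkcond /=.
apply: leq_sum => chi _; case: ifP => // chi0.
pose k s := (#|G| ^ #|(s : {set 'I_n})| * #|[set g | chi g == 0%R]| ^ #|~: s|)%N.
have kle (s : {set 'I_n}) : (#|s| <= d)%N -> (k s * 2 ^ (n - d) <= #|G| ^ n)%N.
  move=> sd; have e1 : (2 ^ (n - d) <= 2 ^ #|~: s|)%N.
    by rewrite leq_pexp2l // cardsCs setCK card_ord leq_sub2l.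
  apply: leq_trans (leq_mul (leqnn _) e1) _; rewrite -mulnA -expnMn.
  apply: leq_trans (_ : #|G| ^ #|s| * #|G| ^ #|~: s| <= _)%N.
    rewrite leq_mul //; case: #|~: s| => // e.
    by rewrite leq_exp2r // mulnC card_dual_ker.
  by rewrite -expnD cardsC card_ord.
have Qk (s : {set 'I_n}) : (#|s| <= d)%N -> (#|Q chi s| <= #|G| ^ n %/ 2 ^ (n - d))%N.
  move=> sd; rewrite leq_divRL ?expn_gt0 //; apply: leq_trans (kle s sd).
  rewrite leq_mul2r; apply/orP; right; rewrite card_family_prod /k -prod_if_card.
  by apply/eq_leq/eq_bigr => i _; case: ifP; rewrite ?cardsT.
apply: leq_trans (leq_mul (nsub_sum Qk) (leqnn _)) _.
by rewrite -mulnA leq_mul // leq_trunc_div.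
Qed.

(** * Skew and alternating forms, and the contribution of codes *)

Definition additive_map (r : {ffun G -> dual}) : bool :=
  [forall x, forall y, r (x - y) == r x - r y].

Definition skew : {set {ffun G -> dual}} :=
  [set r | additive_map r && [forall x, forall y, (r : {ffun G -> dual}) x y + r y x == 0]].

(** These are the skew forms with zero diagonal. For a general skew form r the value r x x is only
    killed by 2. *)
Definition alt : {set {ffun G -> dual}} :=
  [set r | additive_map r && [forall x, (r : {ffun G -> dual}) x x == 0]].

Lemma additive_mapP (r : {ffun G -> dual}) : reflect (zmod_morphism r) (additive_map r).
Proof.
apply: (iffP forallP) => h x; first by move=> y; have /forallP/(_ y)/eqP := h x.
by apply/forallP => y; rewrite h.
Qed.

Lemma zmod_morphismD (U V : zmodType) (f : U -> V) :
  zmod_morphism f -> forall x y, f (x + y) = f x + f y.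
Proof. by move=> fB x y; apply: (addIr (- f y)); rewrite -fB !addrK. Qed.

(* The function given by [almost_function] satisfies the skew relation against
   every value taken by many columns; such values generate G because [F] is a
   code, and this extends the function to a skew form. *)
Lemma skew_approx F D d u : is_code F d -> ((#|G| + 3) * u <= d)%N ->
  (#|badset setT F D u| < 2 * u)%N ->
  exists2 r, r \in skew & (#|[set i | (D i - r (F i) != 0)%R]| <= 2 * u)%N.
Proof.
move=> /forallP Fd ud Bu; set B := badset setT F D u in Bu.
have GN : (0 < #|G|)%N by apply/card_gt0P; exists 0.
have Fd0 (c : dual) : (weight setT F c <= d)%N -> c = 0.
  by move=> cd; apply/eqP; have := Fd c; rewrite ltnNge cd implybF negbK.
have [|r rP] := @almost_function setT F D u.
  move=> c cu; rewrite (Fd0 c); last by apply: leq_trans cu _; apply: leq_trans ud; nia.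
  by have [] := annih_closed setT F.
have {}rP i : i \notin B -> D i = r (F i).
  move=> iB; have /annihP h : D i - r (F i) \in annih setT F by apply: rP; rewrite in_setD iB in_setT.
  apply/eqP; rewrite -subr_eq0; apply/eqP/Fd0.
  by rewrite /weight eq_card0 // => j; rewrite !inE /= h ?eqxx.
have biu i : i \notin B -> (#|bad setT F D i| <= u)%N by rewrite !inE /= -leqNgt.
clearbody B.
(* The popular values, taken at more than u indices outside B. An index outside B has at most u bad
   partners, so one of those indices is not among them. *)
pose Pop := [set h | (u < #|[set i | (i \notin B) && (F i == h)]|)%N].
have skewPop i h : i \notin B -> h \in Pop -> r (F i) h + r h (F i) = 0.
  move=> iB; rewrite inE => uh.
  have /subsetPn[j] : ~~ ([set i | (i \notin B) && (F i == h)] \subset bad setT F D i).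
    by apply: contraTN (leq_ltn_trans (biu i iB) uh) => /subset_leq_card; rewrite -leqNgt.
  rewrite !inE /= => /andP[jB /eqP Fj]; rewrite negbK => /eqP e.
  by rewrite -(rP i iB) -Fj -(rP j jB) addrC.
(* A character vanishing on [Pop] is nonzero only at indices of B, at most 2u of them, and at those
   of at most #|G| unpopular values, at most u for each. The total is within d. *)
have PopP (c : dual) : (forall h, h \in Pop -> c h = 0) -> c = 0.
  move=> ch; apply: Fd0.
  apply: leq_trans (_ : #|B :|: \bigcup_(h in ~: Pop) [set i | (i \notin B) && (F i == h)]| <= _)%N.
    apply/subset_leq_card/subsetP => i; rewrite !inE /=; case: (boolP (i \in B)) => //= iB cFi.
    apply/bigcupP; exists (F i); last by rewrite inE iB eqxx.
    by rewrite inE; apply: contra cFi => /ch ->.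
  apply: leq_trans (leq_card_setU _ _) _; apply: leq_trans ud.
  apply: leq_trans (_ : 2 * u + #|G| * u <= _)%N; last by nia.
  apply: leq_add; first exact: ltnW.
  apply: leq_trans (leq_card_bigcup _ _) _.
  apply: leq_trans (_ : \sum_(h in ~: Pop) u <= _)%N.
    by apply: leq_sum => h; rewrite !inE -leqNgt.
  by rewrite sum_nat_const leq_mul2r max_card orbT.
have PopI h : h \in Pop -> exists2 i, i \notin B & F i = h.
  rewrite inE => uh; have /card_gt0P[i] : (0 < #|[set i | (i \notin B) && (F i == h)]|)%N by lia.
  by rewrite inE => /andP[iB /eqP <-]; exists i.
pose f h : G := if h \in Pop then h else 0.
have gen (c : dual) : (forall h, c (f h) = 0) -> c = 0.
  by move=> cf; apply: PopP => h hP; have := cf h; rewrite /f hP.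
have [U UP] := fin_all_exists (generatedP a_gt0 aG gen).
pose rho := [ffun g => \sum_(h in Pop) r h *+ U g h].
have dsum (I : finType) (P : pred I) (w : I -> dual) g :
    (\sum_(i | P i) w i) g = \sum_(i | P i) w i g.
  by elim/big_rec2: _ => [|i y c _ <-]; rewrite ?dapp0 ?dappD.
have dmuln (c : dual) k g : (c *+ k) g = c g *+ k.
  by elim: k => [|k IHk]; rewrite ?mulr0n ?dapp0 // !mulrS dappD IHk.
(* This removes the dependence of [rho] on the chosen coefficients U, since by [PopP] a character is
   determined by its values on [Pop]. *)
have rhoP g h : h \in Pop -> rho g h = - r h g.
  move=> hP; rewrite ffunE dsum {2}(UP g) raddf_sum /= -sumrN [RHS](bigID (mem Pop)) /=.
  rewrite [X in _ + X]big1 ?addr0 => [|k /negPf kP]; last first.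
    by rewrite /f kP mul0rn raddf0 oppr0.
  apply: eq_bigr => k kP; rewrite dmuln /f kP raddfMn /= -mulNrn; congr (_ *+ _).
  have [i iB <-] := PopI k kP; apply/eqP.
  by rewrite -subr_eq0 opprK skewPop.
have rhoB : zmod_morphism rho.
  move=> x y; apply/eqP; rewrite -subr_eq0; apply/eqP/PopP => h hP.
  by rewrite !dappB !rhoP // raddfB /=; ring.
have rhoPop h : h \in Pop -> rho h = r h.
  move=> hP; apply/eqP; rewrite -subr_eq0; apply/eqP/PopP => k kP.
  rewrite dappB rhoP //; have [i iB Fi] := PopI h hP.
  by have := skewPop i k iB kP; rewrite Fi => e; rewrite -opprD addrC e oppr0.
exists rho.
  rewrite inE; apply/andP; split; first exact/additive_mapP.
  apply/forallP => x; apply/forallP => y; apply/eqP.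
  have [c cE] : exists c : dual, c =1 (fun y => rho x y + rho y x).
    apply: mk_dual => y1 y2; rewrite raddfB /= rhoB dappB; ring.
  rewrite -cE (PopP c) ?dapp0 // => h hP.
  by rewrite cE rhoP // rhoPop // addNr.
apply: leq_trans (ltnW Bu); apply/subset_leq_card/subsetP => i; rewrite inE.
apply: contraNT => iB; rewrite subr_eq0; apply/eqP.
apply/eqP; rewrite -subr_eq0; apply/eqP/PopP => h hP.
by rewrite dappB rhoP // rP // opprK skewPop.
Qed.

Lemma sum_antisym (V : zmodType) (y : 'I_n -> 'I_n -> V) :
  (forall i j, i != j -> y i j + y j i = 0) -> \sum_i \sum_j y i j = \sum_i y i i.
Proof.
move=> yN.
have split_i i : \sum_j y i j = y i i +
    (\sum_(j < n | (i < j)%N) y i j + \sum_(j < n | (j < i)%N) y i j).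
  rewrite (bigD1 i) //=; congr (_ + _); rewrite (bigID (fun j : 'I_n => (i < j)%N)) /=.
  congr (_ + _); apply: eq_bigl => j.
    by rewrite -val_eqE /=; case: ltngtP.
  by rewrite -val_eqE /=; case: ltngtP.
rewrite (eq_bigr _ (fun i _ => split_i i)) !big_split /= [X in _ + (_ + X)](exchange_big_dep predT) //=.
rewrite -big_split /= [X in _ + X]big1 ?addr0 // => i _.
rewrite -big_split /= big1 // => j ij; apply: yN.
by apply: contraTneq ij => ->; rewrite ltnn.
Qed.

Definition rcomp (r : {ffun G -> dual}) F : {ffun 'I_n -> dual} := [ffun i => r (F i)].

Lemma skewP r : r \in skew ->
  zmod_morphism r /\ forall x y, (r : {ffun G -> dual}) x y + r y x = 0.
Proof.
rewrite inE => /andP[/additive_mapP rB /forallP h]; split=> // x y.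
by have /forallP/(_ y)/eqP := h x.
Qed.

(** Off the diagonal the terms of r cancel in pairs, the matrix being symmetric, so r contributes
    only through its own diagonal values. *)
Lemma sform_skew F (r : {ffun G -> dual}) D x : r \in skew ->
  sform setT F (rcomp r F + D) x =
  \sum_i (r (F i) (F i) * x (ue i i) + \sum_j D j (F i) * x (ue i j)).
Proof.
move=> /skewP[rB rN]; rewrite /sform big_split /=.
rewrite -(@sum_antisym _ (fun i j => r (F j) (F i) * x (ue i j))); last first.
  by move=> i j _; rewrite [ue j i]ueC -mulrDl rN mul0r.
rewrite -big_split /=; apply: eq_big => [i|i _]; first by rewrite inE.
rewrite -big_split /=; apply: eq_big => [j|j _]; first by rewrite inE.
by rewrite !ffunE dappD mulrDl.
Qed.

Definition small b : {set {ffun 'I_n -> dual}} := [set D : {ffun 'I_n -> dual} | (#|[set i | D i != 0%R]| <= b)%N].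

Lemma alt_skew : alt \subset skew.
Proof.
apply/subsetP => r; rewrite !inE => /andP[radd /forallP ralt]; rewrite radd /=.
have rD := zmod_morphismD (additive_mapP _ radd).
apply/forallP => x; apply/forallP => y.
have := eqP (ralt (x + y)); rewrite rD dappD !raddfD /= (eqP (ralt x)) (eqP (ralt y)).
by rewrite add0r addr0 => ->.
Qed.

Lemma Ex_om_norm (h : {ffun E -> 'Z_a} -> 'Z_a) : `|Ex (fun x => om (h x))| <= 1.
Proof.
apply: le_trans (Ex_norm m_ge0 _) _; rewrite -(Ex1 m_sum); apply: le_Ex => // x.
by rewrite (om_norm z_prim).
Qed.

(* Summing over all [F], and not only over codes, turns the exponential sum into
   the probability of a linear system with one equation for each column.  A bound on
   each term would lose the rate, since |1 - alpha + alpha * zeta| can exceed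
   1 - alpha. *)
Lemma skew_average r D b : beta <= 1 -> r \in skew -> D \in small b ->
  `|\sum_F Ex (fun x => om (sform setT F (rcomp r F + D) x)) -
    ((r \in alt) && (D == 0))%:R * #|G|%:R ^+ n| <= #|G|%:R ^+ n * beta ^+ (n - b).
Proof.
move=> beta_le1 rS Ds; have [rB rN] := skewP rS; have rD := zmod_morphismD rB.
case: (boolP (_ && _)) => [/andP[ralt /eqP ->]|nralt].
  rewrite mul1r (eq_bigr (fun=> 1)) => [|F _]; last first.
    rewrite -(Ex1 m_sum); apply: eq_Ex => x; rewrite sform_skew // big1 ?om0 // => i _.
    have := ralt; rewrite inE => /andP[_ /forallP/(_ (F i))/eqP ->].
    by rewrite mul0r add0r big1 // => j _; rewrite ffunE dapp0 mul0r.
  rewrite sumr_const card_ffun card_ord natrX subrr normr0.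
  by rewrite mulr_ge0 ?exprn_ge0.
rewrite mul0r subr0 -Ex_sum.
pose psi (x : {ffun E -> 'Z_a}) i g : 'Z_a := r g g * x (ue i i) + \sum_j D j g * x (ue i j).
(* The map sending g to r g g is additive: the cross terms cancel by skewness, and r h h equals its
   negative. *)
have psiB x i : zmod_morphism (psi x i).
  move=> g h; rewrite /psi rB !dappB !raddfB /=.
  have -> : \sum_j D j (g - h) * x (ue i j) = \sum_j D j g * x (ue i j) - \sum_j D j h * x (ue i j).
    by rewrite -sumrB; apply: eq_bigr => j _; rewrite raddfB mulrBl.
  have e1 := rN g h; have e2 := rN h h.
  have -> : r h g = - r g h by apply/eqP; rewrite -subr_eq0 opprK addrC e1.
  have e3 : r h h * x (ue i i) = - (r h h * x (ue i i)).
    by apply/eqP; rewrite -subr_eq0 opprK -mulrDl e2 mul0r.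
  by rewrite [in RHS]e3; ring.
have -> : Ex (fun x => \sum_F om (sform setT F (rcomp r F + D) x)) =
    Ex (fun x => #|G|%:R ^+ n * [forall i, forall g, psi x i g == 0]%:R).
  apply: eq_Ex => x; rewrite -[n in _ ^+ n]card_ord -char_sum_prod //.
  by apply: eq_bigr => F _; rewrite sform_skew.
rewrite ExZl ger0_norm; last by rewrite mulr_ge0 ?exprn_ge0 // Ex_ge0.
rewrite ler_wpM2l ?exprn_ge0 //.
(* As r is not alternating or D is nonzero, some g0 gives a nontrivial equation in every column
   outside the support of D. *)
have [g0 g0P] : exists g0, (exists i, D i g0 != 0) \/ (forall i, D i g0 = 0) /\ r g0 g0 != 0.
  have [D0|] := eqVneq D 0.
    have : ~~ [forall x, (r : {ffun G -> dual}) x x == 0].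
      by move: nralt; rewrite D0 eqxx andbT inE => /nandP[/negP[]|//]; apply/additive_mapP.
    rewrite negb_forall => /existsP[g0 rg0]; exists g0; right; split=> // i.
    by rewrite D0 ffunE dapp0.
  move=> D0; have [i Di] : exists i, D i != 0.
    apply/existsP; apply: contraNT D0 => /existsPn h; apply/eqP/ffunP => i.
    by apply/eqP; have := h i; rewrite negbK ffunE.
  have [g0 Dg0] : exists g0, D i g0 != 0.
    apply/existsP; apply: contraNT Di => /existsPn h; apply/eqP/dual_ext => g.
    by apply/eqP; have := h g; rewrite negbK dapp0.
  by exists g0; left; exists i.
pose s := [set i | D i != 0].
apply: le_trans (_ : beta ^+ (n - #|s|) <= _); last first.
  by rewrite ler_wiXn2l // leq_sub2l //; move: Ds; rewrite inE.
have := @Ex_columns_le (fun i => D i g0) (r g0 g0) s.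
move=> /(_ (fun i => dual_torsion (D i) g0) (dual_torsion (r g0) g0)) h.
apply: le_trans (h _ g0P); last by move=> i; rewrite inE negbK => /eqP ->; rewrite dapp0.
apply: le_Ex => // x; rewrite ler_nat.
case: (boolP [forall i, forall g, psi x i g == 0]) => // /forallP px.
rewrite lt0b; apply/forall_inP => j _; have /forallP/(_ g0)/eqP e := px j.
apply/eqP; rewrite -[RHS]e; congr (_ + _).
by apply: eq_bigr => i _; rewrite ueC.
Qed.

Lemma Ex_left_kernel F :
  #|G|%:R ^+ n * Ex (fun x => (in_left_kernel F x)%:R) =
  \sum_D Ex (fun x => om (sform setT F D x)).
Proof.
rewrite -ExZl -Ex_sum; apply: eq_Ex => x.
have := fourier_indicator setT (colsum F x).
have -> : [forall j in [set: 'I_n], colsum F x j == 0] = in_left_kernel F x.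
  by apply: eq_forallb => j; rewrite inE.
move=> <-; apply: eq_bigr => D _; congr om.
rewrite /sform exchange_big; apply: eq_bigr => j _.
rewrite /colsum raddf_sum /=; apply: eq_big => [i|i _]; first by rewrite inE.
by rewrite dual_mulrn.
Qed.

(** If two pairs give the same sum, then for each h the character sending g to r1 g h - r2 g h
    vanishes at F_i off the supports of D1 and D2. Its weight is at most 4u, so it is 0. *)
Lemma skew_injective F d u : is_code F d -> (4 * u <= d)%N ->
  {in setX skew (small (2 * u)) &, injective (fun p => rcomp p.1 F + p.2)}.
Proof.
move=> /forallP Fd ud [r1 D1] [r2 D2]; rewrite !in_setX /= => /andP[r1S D1S] /andP[r2S D2S] eqD.
have [r1B _] := skewP r1S; have [r2B _] := skewP r2S.
have er : r1 = r2.
  apply/ffunP => g; apply/dual_ext => h; apply/eqP; rewrite -subr_eq0.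
  have [c cE] : exists c : dual, c =1 (fun g => r1 g h - r2 g h).
    by apply: mk_dual => x y; rewrite r1B r2B !dappB; ring.
  rewrite -cE; suff -> : c = 0 by rewrite dapp0.
  apply/eqP; have := Fd c; rewrite implybE negbK => /orP[//|]; rewrite ltnNge => /negP[].
  apply: leq_trans ud; apply: leq_trans (_ : 2 * u + 2 * u <= _)%N; last by lia.
  move: D1S D2S; rewrite !inE => D1S D2S; apply: leq_trans (leq_add D1S D2S).
  apply: leq_trans (leq_card_setU _ _); apply/subset_leq_card/subsetP => i.
  rewrite !inE /= cE; apply: contraNT; rewrite negb_or !negbK => /andP[/eqP D1i /eqP D2i].
  by move/ffunP/(_ i): eqD; rewrite !ffunE D1i D2i !addr0 => ->; rewrite subrr.
by move: eqD; rewrite er => /addrI ->.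
Qed.

(** For D far from every skew form each term is at most [kap ^+ (u * u)]. For D near one, the sum
    over F is taken first so that [skew_average] applies; passing from all F to codes costs at most
    1 per non-code, for each pair (r, D). *)
Lemma code_sum d u : beta <= 1 -> ((#|G| + 3) * u <= d)%N ->
  `|\sum_(F | is_code F d) Ex (fun x => (in_left_kernel F x)%:R) - #|alt|%:R| <=
  #|G|%:R ^+ n * kap ^+ (u * u) + (#|skew| * #|small (2 * u)|)%:R *
  (beta ^+ (n - 2 * u) + #|[set F | ~~ is_code F d]|%:R / #|G|%:R ^+ n).
Proof.
move=> beta_le1 ud; set N := #|G|%:R ^+ n; have N_gt0 : 0 < N by rewrite exprn_gt0 ?G_gt0.
have GN : (0 < #|G|)%N by apply/card_gt0P; exists 0.
pose T F D := Ex (fun x => om (sform setT F D x)).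
pose PS := setX skew (small (2 * u)).
pose im F := [set rcomp p.1 F + p.2 | p in PS].
have T_le1 F D : `|T F D| <= 1 by apply: Ex_om_norm.
have part1 F : is_code F d -> `|\sum_(D | D \notin im F) T F D| <= N * kap ^+ (u * u).
  move=> Fd; apply: le_trans (ler_norm_sum _ _ _) _.
  apply: le_trans (_ : \sum_(D : {ffun 'I_n -> dual}) kap ^+ (u * u) <= _); last first.
    by rewrite sumr_const card_ffun card_ord card_dual // -[_ *+ _]mulr_natl natrX.
  rewrite big_mkcond; apply: ler_sum => D _; case: ifP => [Dim|_]; last exact: kap_exp_ge0.
  have Bu : (2 * u <= #|badset setT F D u|)%N.
    rewrite leqNgt; apply: contraNN Dim => Bu.
    have [r rS Dr] := skew_approx Fd ud Bu; apply/imsetP.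
    exists (r, D - rcomp r F); last by rewrite /= addrC subrK.
    rewrite in_setX rS /= inE; apply: leq_trans Dr; apply/eq_leq/eq_card => i.
    by rewrite !inE !ffunE.
  have := @Ex_om_sform setT F D (fun=> 1) (u * u).
  under eq_Ex => x do rewrite mul1r.
  under [X in _ -> _ -> _ <= X * _]eq_Ex => x do rewrite normr1.
  rewrite (Ex1 m_sum) mul1r => h; apply: h => [e _ x v //|].
  exact: card_coef_neq0.
pose R := \sum_(F | is_code F d) \sum_(D | D \notin im F) T F D.
pose S p := \sum_(F | is_code F d) T F (rcomp p.1 F + p.2).
have E1 : N * \sum_(F | is_code F d) Ex (fun x => (in_left_kernel F x)%:R) = R + \sum_(p in PS) S p.
  rewrite mulr_sumr exchange_big /= -big_split /=; apply: eq_bigr => F Fd.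
  rewrite Ex_left_kernel (bigID (fun D => D \in im F)) /= addrC; congr (_ + _).
  rewrite big_imset //; apply: skew_injective Fd _; apply: leq_trans ud; nia.
have R_le : `|R| <= N * (N * kap ^+ (u * u)).
  apply: le_trans (ler_norm_sum _ _ _) _.
  apply: le_trans (_ : \sum_(F : {ffun 'I_n -> G}) N * kap ^+ (u * u) <= _); last first.
    by rewrite sumr_const card_ffun card_ord -[_ *+ _]mulr_natl natrX.
  rewrite big_mkcond; apply: ler_sum => F _; case: ifP => [/part1 //|_].
  by rewrite mulr_ge0 ?kap_exp_ge0 // ltW.
have S_le p : p \in PS -> `|S p - ((p.1 \in alt) && (p.2 == 0))%:R * N| <=
    N * beta ^+ (n - 2 * u) + #|[set F | ~~ is_code F d]|%:R.
  case: p => r D; rewrite in_setX /= => /andP[rS DS].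
  have := skew_average beta_le1 rS DS; rewrite (bigID (fun F => is_code F d)) /= -/N => h.
  set Y := \sum_(F | ~~ _) _ in h.
  have -> : S (r, D) - ((r \in alt) && (D == 0))%:R * N =
      S (r, D) + Y - ((r \in alt) && (D == 0))%:R * N - Y by ring.
  apply: le_trans (ler_normB _ _) _; apply: lerD => //.
  apply: le_trans (ler_norm_sum _ _ _) _.
  rewrite -sum1dep_card natr_sum ler_sum // => F _; exact: Ex_om_norm.
have E2 : \sum_(p in PS) ((p.1 \in alt) && (p.2 == 0))%:R * N = #|alt|%:R * N.
  rewrite -mulr_suml; congr (_ * _); rewrite -natr_sum; congr (_%:R).
  rewrite -[RHS]muln1 -(cards1 (0 : {ffun 'I_n -> dual})) -cardsX -sum1_card.
  rewrite big_mkcond [RHS]big_mkcond; apply: eq_bigr => -[r D] _.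
  rewrite !in_setX in_set1 /=; case: eqP => [->|_]; last by rewrite !andbF; case: ifP.
  rewrite !andbT; case: (boolP (r \in alt)) => [ra|_]; last by case: ifP.
  rewrite (subsetP alt_skew r ra) /= inE eq_card0 //.
  by move=> k; rewrite !inE ffunE eqxx.
have N0 : N != 0 by rewrite gt_eqF.
have eN : N * `|\sum_(F | is_code F d) Ex (fun x => (in_left_kernel F x)%:R) - #|alt|%:R| =
    `|R + \sum_(p in PS) (S p - ((p.1 \in alt) && (p.2 == 0))%:R * N)|.
  rewrite -{1}(ger0_norm (ltW N_gt0)) -normrM mulrBr E1 [N * #|alt|%:R]mulrC -E2.
  by rewrite -addrA sumrB.
rewrite -(ler_pM2l N_gt0) eN; apply: le_trans (ler_normD _ _) _.
rewrite mulrDr lerD //; apply: le_trans (ler_norm_sum _ _ _) _.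
apply: le_trans (_ : \sum_(p in PS) (N * beta ^+ (n - 2 * u) +
   #|[set F | ~~ is_code F d]|%:R) <= _); first exact: ler_sum.
rewrite sumr_const cardsX -[_ *+ _]mulr_natl mulrCA.
by rewrite [N * (_ + _)]mulrDr [N * (_ / N)]mulrC divfK.
Qed.

Lemma card_small b : (#|small b| <= nsub b * #|G| ^ b)%N.
Proof.
have GN : (0 < #|G|)%N by apply/card_gt0P; exists 0.
pose Q (s : {set 'I_n}) := [set D : {ffun 'I_n -> dual} |
  [forall i, D i \in if i \in s then setT else [set 0]]].
apply: leq_trans (_ : #|[set D | [exists s : {set 'I_n}, (#|s| <= b)%N && (D \in Q s)]]| <= _)%N.
  apply/subset_leq_card/subsetP => D; rewrite !inE => Db; apply/existsP.
  exists [set i | D i != 0]; rewrite Db inE; apply/forallP => i.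
  by rewrite inE; case: eqP => [->|_]; rewrite inE.
apply: nsub_sum => s sb; rewrite card_family_prod.
rewrite (eq_bigr (fun i => if i \in s then #|G| else 1%N)) => [|i _]; last first.
  by case: ifP; rewrite ?cards1 // cardsT card_dual.
by rewrite prod_if_card exp1n muln1 leq_pexp2l.
Qed.

(* The error terms are, in order: surjections that are not codes, characters
   far from every skew form, and characters near a skew form but not alternating. *)
Lemma left_kernel_count_bound d u : beta <= 1 -> ((#|G| + 3) * u <= d)%N ->
  `|\sum_(F | generates F) Ex (fun x => (in_left_kernel F x)%:R) - #|alt|%:R| <=
  (nsub (#|G| * d))%:R * beta ^+ (n - #|G| * d) *
    ((nsub (2 * u) * (2 ^ #|G| * #|G| ^ (#|G| + (#|G| * d + 2 * u))))%:R +
      #|G|%:R ^+ n * kap ^+ (u * u)) +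
  (#|G|%:R ^+ n * kap ^+ (u * u) + (#|skew| * #|small (2 * u)|)%:R *
  (beta ^+ (n - 2 * u) + #|[set F | ~~ is_code F d]|%:R / #|G|%:R ^+ n)).
Proof.
move=> beta_le1 ud; have GN : (0 < #|G|)%N by apply/card_gt0P; exists 0.
rewrite (bigID (fun F => is_code F d)) /= addrC.
have -> : \sum_(F | generates F && is_code F d) Ex (fun x => (in_left_kernel F x)%:R) =
    \sum_(F | is_code F d) Ex (fun x => (in_left_kernel F x)%:R).
  apply: eq_bigl => F; apply: andb_idl => /forallP Fd; apply/forallP => c.
  apply/implyP => /annihP ck; have := Fd c; rewrite implybE negbK => /orP[//|].
  by rewrite /weight eq_card0 // => j; rewrite !inE ck ?inE ?eqxx.
rewrite -addrA; apply: le_trans (ler_normD _ _) _; apply: lerD; last exact: code_sum.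
rewrite ger0_norm; last by apply: sumr_ge0 => F _; apply: Ex_ge0.
by apply: noncode_sum => //; apply: leq_trans ud; nia.
Qed.

End SymForm.

(* 2 - 2 |Z|^2 is the mean of |om (y v) - om (y v')|^2 over two independent
   copies v, v' of the variable with law [m]. *)
Lemma phase_bound (a : nat) (C : numClosedFieldType) (z beta : C) :
  (Zp_trunc a).+2.-primitive_root z -> 0 <= beta -> beta < 1 ->
  exists kap : C, [/\ 0 <= kap, kap < 1 &
    forall (m : 'Z_a -> C) (y : 'Z_a), (forall v, 0 <= m v) -> \sum_v m v = 1 ->
      (forall b, \sum_v m v * (y * v + b == 0)%:R <= beta) ->
      `|\sum_v m v * om z (y * v)| <= kap].
Proof.
move=> z_prim beta_ge0 beta_lt1.
(* Dividing by 4 makes [fac] at most 1, so the product [th] of its values at nonzero u is a positive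
   lower bound for each of them. *)
pose fac (u : 'Z_a) : C := `|1 - om z u| ^+ 2 / 4.
have fac_gt0 u : u != 0 -> 0 < fac u.
  move=> u0; rewrite divr_gt0 // exprn_gt0 // normr_gt0 subr_eq0 eq_sym.
  by rewrite om_eq1.
have fac_le1 u : fac u <= 1.
  rewrite ler_pdivrMr // mul1r (_ : 4 = 2 ^+ 2); last by rewrite -natrX.
  rewrite lerXn2r ?nnegrE //; apply: le_trans (ler_normB _ _) _.
  by rewrite normr1 (om_norm z_prim).
pose th := \prod_(u | u != 0) fac u.
have th_gt0 : 0 < th by apply: prodr_gt0.
have th_le u : u != 0 -> th <= fac u.
  move=> u0; rewrite /th (bigD1 u) //=; apply: ler_piMr; first exact/ltW/fac_gt0.
  by apply: prodr_ile1 => v /andP[v0 _]; rewrite fac_le1 ltW ?fac_gt0.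
have th_le1 : th <= 1 by apply: prodr_ile1 => v v0; rewrite fac_le1 ltW ?fac_gt0.
have b1 : 0 < 1 - beta by rewrite subr_gt0.
have b1' : 1 - beta <= 1 by rewrite lerBlDr lerDl.
(* With t = th * (1 - beta), the argument gives |Z|^2 <= 1 - 2t <= (1 - t)^2, so no square root is
   needed. *)
exists (1 - th * (1 - beta)); split.
- by rewrite subr_ge0; apply: mulr_ile1 => //; apply: ltW.
- by rewrite ltrBlDr ltrDl mulr_gt0.
move=> m y m_ge0 m_sum mb; set Z := \sum_v _.
have omC (u v : 'Z_a) : om z u * (om z v)^* = om z (u - v).
  have vN : om z v * om z (- v) = 1 by rewrite -(omD z_prim) subrr om0.
  have vC : om z v * (om z v)^* = 1 by rewrite -normCK (om_norm z_prim) expr1n.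
  have v0 : om z v != 0 by apply: contraTneq isT => e; move/eqP: vN; rewrite e mul0r eq_sym oner_eq0.
  by rewrite (omD z_prim); congr (_ * _); apply: (mulfI v0); rewrite vN vC.
have facE (u v : 'Z_a) : om z u * (om z v)^* + om z v * (om z u)^* = 2 - 4 * fac (v - u).
  rewrite /fac [4 * _]mulrC divfK ?pnatr_eq0 // normCK rmorphB rmorph1 /= mulrBl !mulrBr !mulr1 !mul1r.
  rewrite -normCK (om_norm z_prim) expr1n !omC.
  have -> : (om z (v - u))^* = om z (u - v).
    by rewrite -[LHS]mul1r -(om0 a z) omC sub0r opprB.
  ring.
have ZE : 2 * `|Z| ^+ 2 = 2 - 4 * \sum_u \sum_v m u * m v * fac (y * v - y * u).
  have e1 : `|Z| ^+ 2 = \sum_u \sum_v m u * m v * (om z (y * u) * (om z (y * v))^*).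
    rewrite normCK rmorph_sum mulr_suml; apply: eq_bigr => u _; rewrite mulr_sumr.
    apply: eq_bigr => v _; rewrite rmorphM /= (CrealP _) ?ger0_real //; ring.
  have e2 : `|Z| ^+ 2 = \sum_u \sum_v m u * m v * (om z (y * v) * (om z (y * u))^*).
    rewrite e1 exchange_big; apply: eq_bigr => u _; apply: eq_bigr => v _.
    by rewrite [m v * _]mulrC.
  rewrite mulr_natl mulr2n {1}e1 e2 -big_split /= mulr_sumr.
  have -> : 2 = \sum_u \sum_v m u * m v * 2 :> C.
    under eq_bigr => u _ do (rewrite -mulr_suml -mulr_sumr m_sum mulr1).
    by rewrite -mulr_suml m_sum mul1r.
  rewrite -sumrB; apply: eq_bigr => u _; rewrite -big_split mulr_sumr -sumrB.
  by apply: eq_bigr => v _ /=; rewrite -mulrDr facE; ring.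
(* For fixed u, [y * v] differs from [y * u] with probability at least 1 - beta, and then [fac] is
   at least [th]. *)
have low : th * (1 - beta) <= \sum_u \sum_v m u * m v * fac (y * v - y * u).
  apply: le_trans (_ : \sum_u m u * (th * (1 - beta)) <= _).
    by rewrite -mulr_suml m_sum mul1r.
  apply: ler_sum => u _; rewrite (eq_bigr (fun v => m u * (m v * fac (y * v - y * u)))); last first.
    by move=> v _; rewrite mulrA.
  rewrite -mulr_sumr ler_wpM2l //.
  apply: le_trans (_ : th * \sum_v m v * (1 - (y * v + (- (y * u)) == 0)%:R) <= _).
    rewrite ler_wpM2l ?(ltW th_gt0) //.
    under eq_bigr => v _ do rewrite mulrBr mulr1.
    by rewrite sumrB m_sum lerB.
  rewrite mulr_sumr; apply: ler_sum => v _; rewrite mulrCA ler_wpM2l //.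
  case: eqP => [->|/eqP h]; last by rewrite subr0 mulr1 th_le.
  by rewrite subrr mulr0 divr_ge0 ?exprn_ge0.
have Z2 : `|Z| ^+ 2 <= 1 - 2 * (th * (1 - beta)).
  rewrite -(ler_pM2l (_ : 0 < 2 :> C)) // ZE.
  have -> : 2 * (1 - 2 * (th * (1 - beta))) = 2 - 4 * (th * (1 - beta)) by ring.
  rewrite lerB //.
  by rewrite ler_wpM2l.
rewrite -(@ler_pXn2r _ 2) ?nnegrE // ?subr_ge0 ?mulr_ile1 ?(ltW th_gt0) ?(ltW b1) //.
apply: le_trans Z2 _.
have -> : (1 - th * (1 - beta)) ^+ 2 = 1 - 2 * (th * (1 - beta)) + (th * (1 - beta)) ^+ 2 by ring.
by rewrite lerDl exprn_ge0 // mulr_ge0 ?ltW.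
Qed.

From mathcomp Require Import generic_quotient ring_quotient finmap.
From mathcomp Require Import all_classical all_reals all_analysis measurable_realfun complex.

Import Order.TTheory GRing.Theory Num.Theory.
Local Open Scope ring_scope.
Local Open Scope classical_set_scope.
Local Open Scope quotient_scope.

Lemma torsion_card (G : finZmodType) (g : G) : g *+ #|G| = 0.
Proof.
have: \sum_(x : G) x = \sum_(x : G) (x + g) by rewrite (reindex_inj (addIr g)).
rewrite big_split /= sumr_const => /eqP.
by rewrite eq_sym -subr_eq0 addrAC subrr add0r => /eqP.
Qed.

(** * Homomorphisms out of quotient groups *)

Section QuotientLift.
Variables (V W : zmodType) (K : zmodClosed V) (f : V -> W).
Hypotheses (fB : zmod_morphism f) (fK : forall k, k \in K -> f k = 0).
Local Notation Q := {ideal_quot K}.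

Lemma quot_liftE x : f (repr (\pi_Q x)) = f x.
Proof.
apply/eqP; rewrite -subr_eq0 -fB; apply/eqP/fK.
by have /eqquotP := reprK (\pi_Q x).
Qed.

Lemma quot_lift_morphism : zmod_morphism (fun q : Q => f (repr q)).
Proof.
pose p : {additive V -> Q} := \pi_Q.
move=> x y; rewrite -fB -[RHS]quot_liftE; congr (f (repr _)).
by rewrite -[\pi_Q]/(p : _ -> _) raddfB /= !reprK.
Qed.

End QuotientLift.

(** The kernel of f is one of the subgroups over which [gen_subgroup] quantifies. *)
Lemma gen_subgroup_ker (V W : zmodType) (S : set V) (f : V -> W) :
  zmod_morphism f -> (forall s, S s -> f s = 0) ->
  forall k, k \in gen_subgroup S -> f k = 0.
Proof.
move=> fB fS k /asboolP kS.
pose P : {pred V} := [pred v | f v == 0].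
have PP : zmod_closed P.
  split=> [|x y]; first by rewrite inE /= -(subrr (0 : V)) fB subrr.
  by rewrite !inE /= fB => /eqP -> /eqP ->; rewrite subrr.
pose H : zmodClosed V := HB.pack P (GRing.isZmodClosed.Build V P PP).
by apply/eqP; apply: (kS H) => s /fS fs; rewrite inE /= fs.
Qed.

Lemma num_elts_image (I : finType) (T : choiceType) (P : {pred I}) (f : I -> T) :
  {in P &, injective f} -> num_elts (f @` [set` P]) = #|P|.
Proof.
move=> fI; rewrite /num_elts.
have -> : fset_set (f @` [set` P]) = [fset f x | x in P]%fset.
  apply/fsetP => y; rewrite in_fset_set; last exact/finite_image/finite_finset.
  apply/idP/imfsetP => [|[x /= xP ->]]; last by rewrite inE; exists x.
  by rewrite inE => -[x xP <-]; exists x.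
rewrite card_in_imfset //= cardE; apply: perm_size.
by apply: uniq_perm; rewrite ?enum_finmem_uniq ?enum_uniq // => x; rewrite enum_finmemE mem_enum.
Qed.

(** Used to give the exterior square the finite group structure that [dual] requires. *)
Lemma num_elts_finZmod (A : zmodType) : finite_set [set: A] ->
  exists fA : finZmodType, exists phi : fA -> A,
    [/\ zmod_morphism phi, bijective phi & num_elts [set: A] = #|fA|].
Proof.
move=> finA; pose e : seq A := enum_fset (fset_set [set: A]).
have eA x : x \in e by rewrite in_fset_set // inE.
have eU : uniq e by apply: fset_uniq.
have eK : pcancel (index^~ e) (onth e).
  by move=> x; rewrite onthE (nth_map x) ?index_mem // nth_index.
have eF : Finite.axiom e by move=> x; rewrite count_uniq_mem ?eA.
pose fA : finZmodType := HB.pack A (PCanIsCountable eK) (fintype.isFinite.Build A eF).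
exists fA, idfun; split; [by []|exact: (Bijective (g := idfun))|].
rewrite -(@num_elts_image fA A predT idfun) //; congr num_elts.
by apply/seteqP; split=> x //= _; exists x.
Qed.

(** * The exterior square and its dual, the alternating forms *)

Section WedgeUniversal.
Variable G : finZmodType.
Local Notation qT := {ideal_quot gen_subgroup (@bilinear_relations G G)}.
Local Notation qW := {ideal_quot gen_subgroup [set tens g g | g in [set: G]]}.

Definition wedge (g h : G) : wedge2 G := \pi_qW (tens g h).

Lemma gen_subgroup_mem (V : zmodType) (S : set V) s : S s -> s \in gen_subgroup S.
Proof. by move=> Ss; apply/asboolP => H; apply. Qed.

Lemma pi_morphism (V : zmodType) (K : zmodClosed V) : zmod_morphism (\pi_{ideal_quot K}).
Proof.
pose p : {additive V -> {ideal_quot K}} := \pi_{ideal_quot K}.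
by move=> x y; rewrite -[\pi_{ideal_quot K}]/(p : _ -> _) raddfB.
Qed.

Lemma pi_eq0 (V : zmodType) (K : zmodClosed V) x : x \in K -> \pi_{ideal_quot K} x = 0.
Proof.
move=> xK; have := pi_morphism K x x; rewrite !subrr => <-.
by apply/eqP; rewrite -Quotient.idealrBE subr0.
Qed.

Lemma zmod_morphism0 (U V : zmodType) (f : U -> V) : zmod_morphism f -> f 0 = 0.
Proof. by move=> fB; rewrite -(subrr (0 : U)) fB subrr. Qed.

Lemma tensDl g g' h : tens (g + g') h = tens g h + tens g' h :> tensor G G.
Proof.
apply/eqP; rewrite -subr_eq0 opprD addrA -!(pi_morphism _ _ _); apply/eqP/pi_eq0.
by apply: gen_subgroup_mem; left; exists g, g', h.
Qed.

Lemma tensDr g h h' : tens g (h + h') = tens g h + tens g h' :> tensor G G.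
Proof.
apply/eqP; rewrite -subr_eq0 opprD addrA -!(pi_morphism _ _ _); apply/eqP/pi_eq0.
by apply: gen_subgroup_mem; right; exists g, h, h'.
Qed.

Lemma wedgeDl g g' h : wedge (g + g') h = wedge g h + wedge g' h.
Proof. by rewrite /wedge tensDl (zmod_morphismD (pi_morphism _)). Qed.

Lemma wedgeDr g h h' : wedge g (h + h') = wedge g h + wedge g h'.
Proof. by rewrite /wedge tensDr (zmod_morphismD (pi_morphism _)). Qed.

Lemma wedgegg g : wedge g g = 0.
Proof. by apply: pi_eq0; apply: gen_subgroup_mem; exists g. Qed.

Lemma wedge_generate (x : wedge2 G) :
  exists r : G * G -> int, x = \sum_p wedge p.1 p.2 *~ r p.
Proof.
have [r rx] : exists r, \pi_qW (\pi_qT r) = x.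
  by exists (repr (repr x)); rewrite !reprK.
pose f : {additive {ffun G * G -> int} -> wedge2 G} := HB.pack (fun r => \pi_qW (\pi_qT r))
  (GRing.isZmodMorphism.Build _ _ (fun r => \pi_qW (\pi_qT r))
     (fun u v => etrans (congr1 _ (pi_morphism _ u v)) (pi_morphism _ _ _))).
exists r; rewrite -rx -[LHS]/(f r) [in LHS](free_gen_sum r) raddf_sum.
by apply: eq_bigr => p _; rewrite raddfMz.
Qed.

(** Extend f linearly to the free group, then descend through the bilinear relations, and finally
    through the subgroup generated by the [tens g g]. *)
Lemma wedge_universal (V : zmodType) (f : G -> G -> V) :
  (forall h, zmod_morphism (f^~ h)) -> (forall g, zmod_morphism (f g)) ->
  (forall g, f g g = 0) ->
  exists F : wedge2 G -> V, zmod_morphism F /\ forall g h, F (wedge g h) = f g h.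
Proof.
move=> fBl fBr fgg.
have fDl h := zmod_morphismD (fBl h); have fDr g := zmod_morphismD (fBr g).
pose L (r : {ffun G * G -> int}) : V := \sum_p f p.1 p.2 *~ r p.
have LB : zmod_morphism L.
  by move=> u v; rewrite -sumrB; apply: eq_bigr => p _; rewrite !ffunE mulrzBr.
have Lgen g h : L (free_gen g h) = f g h.
  rewrite /L (bigD1 (g, h)) //= ffunE eqxx mulr1z big1 ?addr0 // => p /negPf np.
  by rewrite ffunE np mulr0z.
have Lker k : k \in gen_subgroup (@bilinear_relations G G) -> L k = 0.
  apply: (gen_subgroup_ker LB) => _ [[g [g' [h ->]]]|[g [h [h' ->]]]].
    by rewrite !LB !Lgen fDl [f g h + _]addrC addrK subrr.
  by rewrite !LB !Lgen fDr [f g h + _]addrC addrK subrr.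
have TB := quot_lift_morphism LB Lker; set T := (fun q => L (repr q)) in TB.
have Tgen g h : T (tens g h) = f g h by rewrite /T quot_liftE.
have Tker k : k \in gen_subgroup [set tens g g | g in [set: G]] -> T k = 0.
  by apply: (gen_subgroup_ker TB) => _ [g _ <-]; rewrite Tgen fgg.
exists (fun x => T (repr x)); split; first exact: quot_lift_morphism.
by move=> g h; rewrite /wedge quot_liftE.
Qed.

Lemma wedge_torsion (x : wedge2 G) : x *+ #|G| = 0.
Proof.
have [r ->] := wedge_generate x; rewrite -sumrMnl big1 // => p _.
have w0 h : wedge 0 h = 0 by apply: (addrI (wedge 0 h)); rewrite -wedgeDl !addr0.
have wMn g h k : wedge g h *+ k = wedge (g *+ k) h.
  by elim: k => [|k IHk]; rewrite ?mulr0n ?w0 // !mulrS wedgeDl IHk.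
by rewrite pmulrn mulrzAC -pmulrn wMn torsion_card w0 mul0rz.
Qed.

End WedgeUniversal.

(** By the universal property the characters of the exterior square are the alternating forms on G,
    and a finite abelian group has as many characters as elements. *)
Lemma card_alt (G : finZmodType) : #|alt #|G| G| = num_elts [set: wedge2 G].
Proof.
have G_gt0 : (0 < #|G|)%N by apply/card_gt0P; exists 0.
have [fA [phi [phiB [psi psiK phiK] ->]]] := num_elts_finZmod (finite_wedge2 G).
have psiB : zmod_morphism psi.
  by move=> x y; apply: (can_inj psiK); rewrite phiB !phiK.
have phiD := zmod_morphismD phiB; have psiD := zmod_morphismD psiB.
have fA_tor (x : fA) : x *+ #|G| = 0.
  have phiMn k : phi (x *+ k) = phi x *+ k.
    by elim: k => [|k IHk]; rewrite ?mulr0n ?(zmod_morphism0 phiB) // !mulrS phiD IHk.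
  by apply: (can_inj psiK); rewrite phiMn wedge_torsion (zmod_morphism0 phiB).
rewrite -(card_dual G_gt0 fA_tor).
have wB (g h h' : G) : wedge g (h - h') = wedge g h - wedge g h'.
  by apply: (addIr (wedge g h')); rewrite -wedgeDr !subrK.
have wBl (g g' h : G) : wedge (g - g') h = wedge g h - wedge g' h.
  by apply: (addIr (wedge g' h)); rewrite -wedgeDl !subrK.
have theta (c : dual #|G| fA) : {r : {ffun G -> dual #|G| G} |
    forall g h, r g h = c (psi (wedge g h))}.
  have D g : {d : dual #|G| G | forall h, d h = c (psi (wedge g h))}.
    by apply/cid/mk_dual => h h'; rewrite wB psiB raddfB.
  by exists [ffun g => sval (D g)] => g h; rewrite ffunE (svalP (D g)).
pose Th c := sval (theta c); have ThE c g h : Th c g h = c (psi (wedge g h)) := svalP (theta c) g h.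
have psi_sum (I : finType) (f : I -> wedge2 G) (r : I -> int) (c : dual #|G| fA) :
    c (psi (\sum_i f i *~ r i)) = \sum_i c (psi (f i)) *~ r i.
  pose k : {additive wedge2 G -> 'Z_#|G|} := HB.pack (fun x => c (psi x))
    (GRing.isZmodMorphism.Build _ _ (fun x => c (psi x))
       (fun u v => etrans (congr1 c (psiB u v)) (dapp_zmod_morphism c _ _))).
  rewrite -[LHS]/(k _) raddf_sum; apply: eq_bigr => i _; exact: raddfMz.
have Th_inj : injective Th.
  move=> c d cd; apply: dual_ext => x; rewrite -(psiK x).
  have [r ->] := wedge_generate (phi x); rewrite !psi_sum.
  by apply: eq_bigr => p _; rewrite -!ThE cd.
have -> : #|{: dual #|G| fA}| = #|(Th @: predT)%SET| by rewrite card_imset.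
apply: eq_card => r; apply/idP/imsetP.
  rewrite inE => /andP[/additive_mapP rB /forallP rgg].
  have [F [FB Fw]] := @wedge_universal G _ (fun g h => r g h)
    (fun h g g' => etrans (congr1 (fun d => dapp d h) (rB g g')) (dappB _ _ _))
    (fun g => dapp_zmod_morphism (r g)) (fun g => eqP (rgg g)).
  have [c cE] : exists c : dual #|G| fA, c =1 (fun x => F (phi x)).
    by apply: mk_dual => x y; rewrite phiB FB.
  exists c => //; apply/ffunP => g; apply/dual_ext => h.
  by rewrite ThE cE phiK Fw.
move=> [c _ ->]; rewrite inE; apply/andP; split.
  apply/additive_mapP => x y; apply/dual_ext => h.
  by rewrite dappB !ThE wBl psiB raddfB.
by apply/forallP => x; rewrite ThE wedgegg (zmod_morphism0 psiB) raddf0.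
Qed.

(** * Surjections from the cokernel as generating families *)

Section SurjectionsOfCokernel.
Variables (n : nat) (X : 'M[int]_n) (G : finZmodType).
Local Notation Q := {ideal_quot colspan X}.
Local Notation a := #|G|.

Definition kills_columns (F : {ffun 'I_n -> G}) : bool := [forall j, \sum_i F i *~ X i j == 0].

Definition cv_ev (F : {ffun 'I_n -> G}) (v : 'cV[int]_n) : G := \sum_i F i *~ v i 0.

Lemma cv_evB F : zmod_morphism (cv_ev F).
Proof.
by move=> u v; rewrite -sumrB; apply: eq_bigr => i _; rewrite !mxE mulrzBr.
Qed.

Lemma cv_ev_delta F i : cv_ev F (delta_mx i 0) = F i.
Proof.
rewrite /cv_ev (bigD1 i) //= mxE !eqxx mulr1z big1 ?addr0 // => j /negPf ji.
by rewrite mxE ji mulr0z.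
Qed.

Lemma cv_ev_colspan F v : kills_columns F -> v \in colspan X -> cv_ev F v = 0.
Proof.
move=> /forallP kF /asboolP[u ->]; rewrite /cv_ev.
under eq_bigr => i _ do rewrite mxE mulrz_sumr.
rewrite exchange_big big1 //= => j _.
under eq_bigr => i _ do rewrite mulrzA.
by rewrite -mulrz_suml (eqP (kF j)) mul0rz.
Qed.

Definition cok_map (F : {ffun 'I_n -> G}) : cok X -> G := fun x => cv_ev F (repr x).

Lemma cok_mapE F v : kills_columns F -> cok_map F (\pi_Q v) = cv_ev F v.
Proof.
by move=> kF; apply: quot_liftE; [apply: cv_evB|move=> k; apply: cv_ev_colspan].
Qed.

Lemma cok_map_inj : {in kills_columns &, injective cok_map}.
Proof.
move=> F F' kF kF' e; apply/ffunP => i.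
by rewrite -!cv_ev_delta -!cok_mapE // e.
Qed.

(** A character vanishing on every F_i vanishes on the image of the map. Conversely [generatedP]
    writes any g as a combination of the F_i, whose coefficients form a preimage vector. *)
Lemma cok_map_surj F : kills_columns F ->
  (forall g, exists x, cok_map F x = g) <-> generates a F.
Proof.
have G_gt0 : (0 < a)%N by apply/card_gt0P; exists 0.
move=> kF; split=> [FS|/forallP Fg].
  apply/forallP => c; apply/implyP => /annihP ck; apply/eqP/dual_ext => g.
  have [x <-] := FS g; rewrite dapp0 /cok_map /cv_ev raddf_sum big1 // => i _.
  by rewrite raddfMz /= ck ?inE // mul0rz.
move=> g; have [|u ->] := generatedP G_gt0 (@torsion_card G) (f := F) _ g.
  by move=> c ck; apply/eqP/(implyP (Fg c))/annihP => j _; apply: ck.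
exists (\pi_Q (\col_i (u i)%:Z)); rewrite cok_mapE //.
by apply: eq_bigr => i _; rewrite mxE pmulrn.
Qed.

Lemma num_elts_Sur :
  num_elts (Sur (cok X) G) = #|[pred F | kills_columns F && generates a F]|.
Proof.
rewrite -(@num_elts_image _ _ [pred F | kills_columns F && generates a F] cok_map); last first.
  by move=> F F' /andP[kF _] /andP[kF' _]; apply: cok_map_inj.
congr num_elts; apply/seteqP; split=> [f [fB fS]|_ [F /andP[kF gF] <-]]; last first.
  split; last exact/(cok_map_surj kF).
  by apply: quot_lift_morphism; [apply: cv_evB|move=> k; apply: cv_ev_colspan].
pose F : {ffun 'I_n -> G} := [ffun i => f (\pi_Q (delta_mx i 0))].
pose f' : {additive 'cV[int]_n -> G} := HB.pack (fun v => f (\pi_Q v))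
  (GRing.isZmodMorphism.Build _ _ (fun v => f (\pi_Q v))
     (fun u v => etrans (congr1 f (pi_morphism (colspan X) u v)) (fB _ _))).
have fE v : f (\pi_Q v) = cv_ev F v.
  rewrite -[LHS]/(f' v) {1}(matrix_sum_delta v) raddf_sum; apply: eq_bigr => i _.
  by rewrite big_ord1 ffunE -[f _]/(f' _) -raddfMz -scaler_int intz.
have kF : kills_columns F.
  apply/forallP => j; apply/eqP; transitivity (cv_ev F (col j X)).
    by apply: eq_bigr => i _; rewrite mxE.
  rewrite -fE pi_eq0 ?(zmod_morphism0 fB) //.
  by apply/asboolP; exists (delta_mx j 0); rewrite colE.
have fF : cok_map F = f by apply/funext => x; rewrite /cok_map -fE reprK.
exists F => //; apply/andP; split=> //; apply/(cok_map_surj kF).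
by rewrite fF.
Qed.

End SurjectionsOfCokernel.

(** * Random variables with finitely many values *)

Section FiniteValued.
Variables (R : realType) (d : measure_display) (T : measurableType d) (P : probability T R).
Variables (I : finType) (xi : T -> I).
Hypothesis mxi : forall i, measurable [set w | xi w = i].

Lemma expectation_finite (h : I -> R) : (forall i, 0 <= h i) ->
  'E_P[fun w => h (xi w)]%E = (\sum_i h i * fine (P [set w | xi w = i]))%:E.
Proof.
move=> h0; rewrite unlock.
have -> : (fun w => (h (xi w))%:E) =
    (fun w => \sum_(i <- index_enum I) ((h i)%:E * (\1_[set w | xi w = i] w)%:E)%E)%E.
  apply/funext => w; rewrite (bigD1 (xi w)) //= indicE mem_set // mule1 big1 ?adde0 // => i ni.
  by rewrite indicE memNset ?mule0 //= => e; rewrite e eqxx in ni.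
have mi i : measurable_fun setT (EFin \o (\1_[set w | xi w = i] : T -> R)).
  by apply/measurable_EFinP; apply: measurable_indic.
rewrite ge0_integral_sum //; last 2 first.
- by move=> i; apply: measurable_funeM; apply: mi.
- by move=> i w _; rewrite mule_ge0 // lee_fin.
rewrite -sumEFin; apply: eq_bigr => i _.
have i0 w : setT w -> (0 <= (\1_[set w | xi w = i] w : R)%:E)%E by rewrite lee_fin.
rewrite (ge0_integralZl_EFin P measurableT i0 (mi i) (h0 i)).
by rewrite integral_indic // setIT EFinM fineK // fin_num_measure.
Qed.

Lemma sum_fibers : \sum_i fine (P [set w | xi w = i]) = 1.
Proof.
have := expectation_finite (fun=> ler01); rewrite expectation_cst => -[->].
by apply: eq_bigr => i _; rewrite mul1r.
Qed.

Lemma sum_fibers_pred (B : pred I) :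
  \sum_i fine (P [set w | xi w = i]) * (B i)%:R = fine (P [set w | B (xi w)]).
Proof.
have mB : measurable [set w | B (xi w)].
  have -> : [set w | B (xi w)] = \bigcup_(i in [set` B]) [set w | xi w = i].
    by apply/seteqP; split=> [w /= Bw|w [i /= Bi ->]//]; exists (xi w).
  by apply: fin_bigcup_measurable => // i _; apply: mxi.
have := @expectation_finite (fun i => (B i)%:R) (fun i => ler0n _ _).
rewrite unlock (_ : (fun w => _) = (fun w => (\1_[set w | B (xi w)] w)%:E)); last first.
  by apply/funext => w; rewrite indicE; congr ((nat_of_bool _)%:R%:E); apply/idP/idP; rewrite inE.
rewrite integral_indic // setIT => ->; rewrite /=.
by apply: eq_bigr => i _; rewrite mulrC.
Qed.

End FiniteValued.

(** * Residues of integers modulo |G| and modulo its prime factors *)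

Lemma intr_Zp_eq0 (a : nat) (k : int) : (1 < a)%N -> (k%:~R == 0 :> 'Z_a) = (a %| `|k|)%N.
Proof.
move=> a1; have h (m : nat) : (m%:R == 0 :> 'Z_a) = (a %| m)%N.
  by rewrite Zp_nat -val_eqE /= Zp_cast.
by case: k => m; rewrite ?NegzE ?mulrNz ?oppr_eq0 ?abszN -?pmulrn h.
Qed.

Lemma intr_Fp_eq0 (p : nat) (k : int) : prime p -> (k%:~R == 0 :> 'F_p) = (p %| `|k|)%N.
Proof.
move=> pp; have h (m : nat) : (m%:R == 0 :> 'F_p) = (p %| m)%N.
  by rewrite (dvdn_pcharf (pchar_Fp pp)).
by case: k => m; rewrite ?NegzE ?mulrNz ?oppr_eq0 ?abszN -?pmulrn h.
Qed.

(** With g = gcd (a, y), the equation y k = 0 modulo a forces a / g to divide k, and a / g > 1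
    because 0 < y < a. Any prime factor p of a / g will do. *)
Lemma torsion_eq_Fp (a : nat) (y : 'Z_a) : (0 < a)%N -> y != 0 -> y *+ a = 0 ->
  exists2 p, prime p /\ (p %| a)%N &
    forall k : int, y * k%:~R = 0 -> k%:~R = 0 :> 'F_p.
Proof.
move=> a0 y0 ya; have a1 : (1 < a)%N.
  by case: a a0 y y0 ya => [|[|a]] // _ y y0; rewrite mulr1n => y00; rewrite y00 eqxx in y0.
have yE : y = (y : nat)%:R by rewrite natr_Zp.
have ylt : (y < a)%N by rewrite -[X in (_ < X)%N](Zp_cast a1).
have ygt : (0 < y)%N by rewrite lt0n.
set g := gcdn a y.
have g0 : (0 < g)%N by rewrite gcdn_gt0 a0.
have ag1 : (1 < a %/ g)%N.
  rewrite ltn_divRL ?dvdn_gcdl // mul1n.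
  by apply: leq_ltn_trans (dvdn_leq ygt (dvdn_gcdr a y)) ylt.
exists (pdiv (a %/ g)).
  split; first exact: pdiv_prime.
  by apply: dvdn_trans (pdiv_dvd _) _; apply: dvdn_div; apply: dvdn_gcdl.
move=> k /eqP; rewrite yE -[(y : nat)%:R]mulr1 -mulrA mul1r.
have -> : (y : nat)%:R * k%:~R = ((y : nat)%:Z * k)%:~R :> 'Z_a by rewrite intrM.
rewrite intr_Zp_eq0 // abszM /= => ayk; apply/eqP; rewrite intr_Fp_eq0 ?pdiv_prime //.
apply: dvdn_trans (pdiv_dvd _) _.
rewrite -(@Gauss_dvdr _ (y %/ g)%N); last first.
  rewrite /coprime -(eqn_pmul2r g0) mul1n muln_gcdl !divnK ?dvdn_gcdl ?dvdn_gcdr //.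
by rewrite -(@dvdn_pmul2r g) // divnK ?dvdn_gcdl // mulnAC divnK ?dvdn_gcdr.
Qed.

Lemma mulrz_Zp (G : finZmodType) (g : G) (k : int) :
  g *~ k = g *+ (k%:~R : 'Z_#|G|).
Proof.
(* When G is trivial ['Z_1] is Z/2, but every multiple in G is then 0. *)
have [a1|a1] := ltnP 1 #|G|; last first.
  have g0 : g = 0 by apply: (card_le1_eqP a1).
  by rewrite g0 mul0rz mul0rn.
have gM (m : nat) : g *+ (m%:R : 'Z_#|G|) = g *+ m.
  rewrite Zp_nat /= Zp_cast // [in RHS](divn_eq m #|G|) mulrnDr mulnC mulrnA.
  by rewrite torsion_card mul0rn add0r.
have kE := divz_eq k #|G|%:Z.
have r0 : (0 <= k %% #|G|)%Z by rewrite modz_ge0 // gt_eqF // ltz_nat ltnW.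
have -> : k%:~R = (`|(k %% #|G|)%Z|%N)%:R :> 'Z_#|G|.
  rewrite [in LHS]kE intrD intrM -[(#|G|%:Z)%:~R]/(#|G|%:R).
  have -> : #|G|%:R = 0 :> 'Z_#|G| by apply/eqP; rewrite -[#|G|%:R]/((#|G|%:Z)%:~R) intr_Zp_eq0.
  by rewrite mulr0 add0r -[in LHS](gez0_abs r0).
rewrite gM [in LHS]kE mulrzDr mulrC mulrzA -pmulrn torsion_card mul0rz add0r.
by rewrite -[in LHS](gez0_abs r0) -pmulrn.
Qed.

Section UpperIndex.
Variable n : nat.

Lemma upper_subproof (i j : 'I_n) :
  let p := if (i <= j)%N then (i, j) else (j, i) in (p.1 <= p.2)%N.
Proof. by rewrite /=; case: (leqP i j) => /= [|/ltnW]. Qed.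

Definition upper (i j : 'I_n) : upper_index n :=
  exist _ (if (i <= j)%N then (i, j) else (j, i)) (upper_subproof i j).

Lemma upperC i j : upper i j = upper j i.
Proof.
apply: val_inj => /=; case: (ltngtP i j) => // ij.
by rewrite (ord_inj ij).
Qed.

Lemma upper_inj i j k l : upper i j = upper k l -> (i = k /\ j = l) \/ (i = l /\ j = k).
Proof.
move=> /(congr1 val) /=.
by case: ifP; case: ifP => _ _ [-> ->]; [left|right|right|left].
Qed.

End UpperIndex.

(** * From the random matrix to a product law on residues *)

Section Reduction.
Variables (R : realType) (d : measure_display) (T : measurableType d) (P : probability T R).
Variables (n : nat) (X : T -> 'M[int]_n) (G : finZmodType).
Hypothesis XP : random_symmetric_matrix P X.
Local Notation a := #|G|.

Definition residue (e : upper_index n) (w : T) : 'Z_a := (X w (val e).1 (val e).2)%:~R.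

Definition residues (w : T) : {ffun upper_index n -> 'Z_a} := [ffun e => residue e w].

Definition residue_law (e : upper_index n) (t : 'Z_a) : R := fine (P [set w | residue e w = t]).

Lemma residue_measurable e t : measurable [set w | residue e w = t].
Proof. exact: (rsm_measurable XP _ _ [set k | k%:~R = t :> 'Z_a]). Qed.

Lemma residues_fiber x :
  [set w | residues w = x] = \bigcap_(e in [set` [set: upper_index n]%SET]) [set w | residue e w = x e].
Proof.
apply/seteqP; split=> [w /= <- e _|w /= h]; first by rewrite ffunE.
by apply/ffunP => e; rewrite ffunE; apply: h; rewrite /= inE.
Qed.

Lemma residues_measurable x : measurable [set w | residues w = x].
Proof.
rewrite residues_fiber; apply: fin_bigcap_measurable; first exact: finite_finset.
by move=> e _; apply: residue_measurable.
Qed.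

Lemma residues_law x : fine (P [set w | residues w = x]) = \prod_e residue_law e (x e).
Proof.
rewrite residues_fiber.
have := rsm_independent XP [set: upper_index n]%SET (fun e => [set k : int | k%:~R = x e :> 'Z_a]).
by move=> ->; apply: eq_bigl => e; rewrite inE.
Qed.

Lemma residue_law_ge0 e t : 0 <= residue_law e t.
Proof. by rewrite fine_ge0. Qed.

Lemma residue_law_sum e : \sum_t residue_law e t = 1.
Proof. exact: (sum_fibers P (residue_measurable e)). Qed.

(** Two integer solutions of y k + b = 0 differ by a solution of y k = 0, so by [torsion_eq_Fp] all
    of them lie in one residue class modulo a single prime p dividing #|G|, where the hypothesis
    applies. *)
Lemma residue_law_ball alpha : alpha <= 1 ->
  (forall (p : nat) (t : 'F_p) (i j : 'I_n),
    prime p -> (p %| #|G|)%N -> (i <= j)%N ->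
    (P [set w | (X w i j)%:~R = t :> 'F_p] <= (1 - alpha)%:E)%E) ->
  forall e (y b : 'Z_a), y != 0 -> y *+ a = 0 ->
    \sum_t residue_law e t * (y * t + b == 0)%:R <= 1 - alpha.
Proof.
move=> alpha1 ball e y b y0 ya; have a0 : (0 < a)%N by apply/card_gt0P; exists 0.
have [p [pp pa] pk] := torsion_eq_Fp a0 y0 ya.
rewrite (sum_fibers_pred P (residue_measurable e) (fun t => y * t + b == 0)).
set D := [set w | _].
have mD : measurable D := rsm_measurable XP _ _ [set k | y * k%:~R + b == 0].
have [[w0 Dw0]|noD] := pselect (exists w, D w); last first.
  have -> : D = set0 by apply/seteqP; split=> // w Dw; case: noD; exists w.
  by rewrite measure0 subr_ge0.
rewrite -lee_fin fineK; last exact: fin_num_measure.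
apply: le_trans (ball p ((X w0 (val e).1 (val e).2)%:~R) _ _ pp pa (valP e)).
apply: le_measure; rewrite ?inE //.
  exact: (rsm_measurable XP _ _ [set k | k%:~R = _ :> 'F_p]).
move=> w /eqP Dw /=; apply/eqP; rewrite -subr_eq0 -intrB; apply/eqP/pk.
move/eqP: Dw0 => Dw0; apply: (addIr b); rewrite intrB mulrBr add0r.
by rewrite -[y * _%:~R in X in X - _](addrK b) Dw -[y * _](addrK b) Dw0; ring.
Qed.

Lemma kills_columns_in_left_kernel w (F : {ffun 'I_n -> G}) :
  kills_columns (X w) F = in_left_kernel (@upper n) F (residues w).
Proof.
apply: eq_forallb => j; congr (_ == 0); apply: eq_bigr => i _.
rewrite mulrz_Zp ffunE; congr (_ *+ nat_of_ord _%:~R); rewrite /=; case: leqP => // _.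
by have := rsm_symmetric XP w => /matrixP/(_ i j); rewrite mxE.
Qed.

Lemma expectation_Sur :
  'E_P[fun w => (num_elts (Sur (cok (X w)) G))%:R]%E =
  (\sum_(F : {ffun 'I_n -> G} | generates a F) Ex residue_law (fun x => (in_left_kernel (@upper n) F x)%:R))%:E.
Proof.
pose h (x : {ffun upper_index n -> 'Z_a}) : R := \sum_(F : {ffun 'I_n -> G} | generates a F) (in_left_kernel (@upper n) F x)%:R.
rewrite (_ : (fun w => _) = (fun w => h (residues w))); last first.
  apply/funext => w; rewrite num_elts_Sur -sum1_card natr_sum /h big_mkcond [RHS]big_mkcond.
  apply: eq_bigr => F _; rewrite inE kills_columns_in_left_kernel andbC.
  by case: (generates a F) => //=; case: in_left_kernel.
rewrite (expectation_finite P residues_measurable); last by move=> x; apply: sumr_ge0.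
congr _%:E; rewrite -Ex_sum; apply: eq_bigr => x _.
by rewrite residues_law mulrC.
Qed.

End Reduction.

(** * Exponential decay of the error terms *)

Section Asymptotics.
Variable R : realType.

(** Expand (1 + x)^n as the sum of x^|B| over all subsets B; a subset of size at most b contributes
    at least x^b. *)
Lemma nsub_bound (n b : nat) (x : R) : 0 < x -> x <= 1 ->
  (nsub n b)%:R * x ^+ b <= (1 + x) ^+ n.
Proof.
move=> x0 x1.
have -> : (1 + x) ^+ n = \sum_(B : {set 'I_n}) x ^+ #|B|.
  rewrite addrC -[n in LHS]card_ord -prodr_const.
  rewrite (@bigA_distr _ _ _ *%R +%R _ (fun=> x) (fun=> 1)) /=.
  apply: eq_bigr => B _; rewrite -big_mkcond prodr_const //.
apply: le_trans (_ : \sum_(B in [set B : {set 'I_n} | (#|B| <= b)%N]%SET) x ^+ #|B| <= _).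
  rewrite mulr_natl -sumr_const; apply: ler_sum => B; rewrite inE => Bb.
  by rewrite ler_wiXn2l // ltW.
rewrite big_mkcond; apply: ler_sum => B _; case: ifP => // _.
by rewrite exprn_ge0 // ltW.
Qed.

Lemma expR_pow (x : R) (n : nat) : expR (x * n%:R) = expR x ^+ n.
Proof. by rewrite mulrC expRM_natl. Qed.

(** It suffices that k be at least M ln Z / eps, since k (n %/ k) <= n. The condition M <= k keeps M
    (n %/ k) below or equal to n. *)
Lemma power_exp_bound (M : nat) (Z eps : R) : 1 <= Z -> 0 < eps ->
  exists k : nat, [/\ (0 < k)%N, (M <= k)%N &
    forall n, Z ^+ (M * (n %/ k)) <= expR (eps * n%:R)].
Proof.
move=> Z1 eps0; have Z0 : 0 < Z by apply: lt_le_trans Z1.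
have lnZ : 0 <= ln Z by apply: ln_ge0.
pose r := M%:R * ln Z / eps.
have r0 : 0 <= r by apply: divr_ge0; [apply: mulr_ge0|apply: ltW].
exists ((Num.trunc r).+1 + M)%N; split=> [||n]; [by rewrite addSn|exact: leq_addl|].
set k := (_ + M)%N.
have rk : r <= k%:R.
  have /andP[_ h] := trunc_itv r0; apply: le_trans (ltW h) _.
  by rewrite ler_nat leq_addr.
rewrite -[Z]lnK ?posrE // -expR_pow ler_expR.
have kn : k%:R * (n %/ k)%:R <= n%:R :> R by rewrite -natrM ler_nat mulnC leq_trunc_div.
apply: le_trans (_ : eps * (k%:R * (n %/ k)%:R) <= _); last by rewrite ler_wpM2l // ltW.
rewrite natrM mulrA mulrA ler_wpM2r // mulrC -ler_pdivrMl //.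
by rewrite [X in X <= _]mulrC.
Qed.

(** With u = n %/ k the logarithm is at most A (u + 1) - eta u^2, and completing the square bounds
    this by A + A^2 / (4 eta). *)
Lemma gaussian_decay (kap Q : R) (k : nat) : 0 <= kap -> kap < 1 -> 1 <= Q -> (0 < k)%N ->
  exists2 K : R, 0 < K & forall n, Q ^+ n * kap ^+ (n %/ k * (n %/ k)) <= K.
Proof.
move=> kap0 kap1 Q1 k0; have Q0 : 0 < Q by apply: lt_le_trans Q1.
pose A := k%:R * ln Q; pose eta := 1 - kap.
have eta0 : 0 < eta by rewrite subr_gt0.
have A0 : 0 <= A by rewrite mulr_ge0 ?ln_ge0.
exists (expR (A + A ^+ 2 / (4 * eta))); first exact: expR_gt0.
move=> n; set u := (n %/ k)%N.
have kapE : kap <= expR (- eta).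
  by apply: le_trans (expR_ge1Dx _); rewrite /eta; lra.
have e1 : kap ^+ (u * u) <= expR (- eta * (u * u)%:R).
  by rewrite expR_pow lerXn2r ?nnegrE ?expR_ge0.
have e2 : Q ^+ n <= expR (A * (u%:R + 1)).
  rewrite -[Q]lnK ?posrE // -expR_pow ler_expR /A.
  have : n%:R <= k%:R * (u%:R + 1) :> R.
    by rewrite natr1 -natrM ler_nat; have := ltn_ceil n k0; rewrite -/u; nia.
  have := ln_ge0 Q1; nra.
apply: le_trans (ler_pM _ _ e2 e1) _; rewrite ?exprn_ge0 //; first exact: ltW.
rewrite -expRD ler_expR natrM.
have -> : A ^+ 2 / (4 * eta) = eta * (A / (2 * eta)) ^+ 2.
  by field; lra.
have AE : A = 2 * eta * (A / (2 * eta)) by field; lra.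
set t := A / (2 * eta) in AE *; rewrite {1 2}AE.
have : 0 <= eta * (u%:R - t) ^+ 2 by rewrite mulr_ge0 ?sqr_ge0 // ltW.
nra.
Qed.

Lemma nsub_mono (n b b' : nat) : (b <= b')%N -> (nsub n b <= nsub n b')%N.
Proof.
by move=> bb'; apply/subset_leq_card/fintype.subsetP => B; rewrite !inE => /leq_trans; apply.
Qed.

Lemma nsub_gt0 (n b : nat) : (0 < nsub n b)%N.
Proof. by apply/card_gt0P; exists (finset.set0); rewrite inE cards0. Qed.

Lemma pow_sub_le (beta Z : R) (n j l : nat) : 0 < beta -> beta^-1 <= Z -> 1 <= Z ->
  (j <= l)%N -> (l <= n)%N -> beta ^+ (n - j) <= beta ^+ n * Z ^+ l.
Proof.
move=> b0 bZ Z1 jl ln; have jn : (j <= n)%N := leq_trans jl ln.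
rewrite -{2}(subnK jn) exprD -mulrA; apply: ler_peMr; first by rewrite exprn_ge0 // ltW.
apply: le_trans (_ : beta ^+ j * Z ^+ j <= _).
  rewrite -exprMn exprn_ege1 //.
  by rewrite -(mulfV (lt0r_neq0 b0)) ler_wpM2l // ltW.
by apply: ler_wpM2l; [rewrite exprn_ge0 // ltW|apply: ler_weXn2l].
Qed.

(** Here [sm] stands for the number of D of small support and [nc] for the proportion of non-codes.
    A large k makes the growth of all counting factors fit into the gap between c and min (alpha, ln
    2). *)
Lemma error_decay (N S0 : nat) (alpha kap c : R) : (0 < N)%N ->
  0 < alpha -> alpha < 1 -> 0 <= kap -> kap < 1 -> c < Num.min alpha (ln 2) ->
  exists k : nat, exists2 K : R, 0 < K & forall (n : nat) (sm nc : R),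
    let u := (n %/ k)%N in let d := ((N + 3) * u)%N in
    0 <= sm -> 0 <= nc ->
    sm <= (nsub n (2 * u) * N ^ (2 * u))%:R -> nc <= (N * nsub n d)%:R * 2^-1 ^+ (n - d) ->
    (nsub n (N * d))%:R * (1 - alpha) ^+ (n - N * d) *
      ((nsub n (2 * u) * (2 ^ N * N ^ (N + (N * d + 2 * u))))%:R + N%:R ^+ n * kap ^+ (u * u)) +
    (N%:R ^+ n * kap ^+ (u * u) + S0%:R * sm * ((1 - alpha) ^+ (n - 2 * u) + nc)) <=
    K * expR (- (c * n%:R)).
Proof.
move=> N0 a0 a1 kap0 kap1 c_lt; set mn := Num.min _ _ in c_lt.
have ln2 : 0 < ln 2 :> R by rewrite ln_gt0 // ltr1n.
have mn0 : 0 < mn by rewrite lt_min a0.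
have [mna mnl] : mn <= alpha /\ mn <= ln 2 by split; rewrite ge_min lexx ?orbT.
(* The counting factors below amount to at most exp (8 eps n), that is exp ((mn - c) n). *)
pose eps := (mn - c) / 8.
have eps0 : 0 < eps by rewrite divr_gt0 // subr_gt0.
pose x := Num.min 1 eps.
have x0 : 0 < x by rewrite lt_min ltr01.
have [x1 xe] : x <= 1 /\ x <= eps by split; rewrite ge_min lexx ?orbT.
pose beta := 1 - alpha.
have b0 : 0 < beta by rewrite subr_gt0.
have b1 : beta <= 1 by rewrite /beta; lra.
(* A single base dominating N, 2, 1 / beta and 1 / x, so that all auxiliary powers are bounded by
   powers of Z. *)
pose Z := (N%:R + 2) / (beta * x).
have bx0 : 0 < beta * x by rewrite mulr_gt0.
have N1 : 1 <= N%:R :> R by rewrite ler1n.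
have ZN : N%:R + 2 <= Z.
  rewrite ler_pdivlMr //; apply: ler_piMr; first by rewrite addr_ge0.
  by apply: mulr_ile1 => //; apply: ltW.
have Zb : beta^-1 <= Z by rewrite ler_pdivlMr // mulKf ?lt0r_neq0 //; lra.
have Zx : x^-1 <= Z by rewrite ler_pdivlMr // mulrCA mulVf ?lt0r_neq0 //; lra.
have Z1 : 1 <= Z by lra.
have Z2 : 2^-1^-1 <= Z by rewrite invrK; lra.
(* With d = (N + 3) u, the largest exponent that occurs, N d + 2u, equals M u. *)
pose M := (N * (N + 3) + 2)%N.
have [k [k0 Mk kP]] := power_exp_bound M Z1 eps0.
(* The factor [expR mn] in the base makes the quadratic decay absorb N^n and still yield exp (- mn
   n). *)
have Q1 : 1 <= N%:R * expR mn.
  rewrite -[leLHS]mulr1 ler_pM //; apply: le_trans (expR_ge1Dx _); lra.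
have [K2 K20 K2P] := gaussian_decay kap0 kap1 Q1 k0.
pose K1 : R := (2 ^ N * N ^ N)%:R + 2 * K2 + S0%:R + S0%:R * N%:R.
have K10 : 0 < K1.
  have h1 : 0 <= (2 ^ N * N ^ N)%:R :> R by [].
  have h2 : 0 <= S0%:R * N%:R :> R by rewrite mulr_ge0.
  have h3 : 0 <= S0%:R :> R by [].
  by rewrite /K1; lra.
exists k, K1 => // n sm nc u d sm0 nc0 smP ncP.
pose l := (M * u)%N; set S := (nsub n l)%:R : R; set W := Z ^+ l.
set e2 := expR (eps * n%:R); have We : W <= e2 by apply: kP.
have W1 : 1 <= W by apply: exprn_ege1.
have S1 : 1 <= S by rewrite ler1n nsub_gt0.
have ln : (l <= n)%N.
  by apply: leq_trans (leq_trunc_div n k); rewrite mulnC leq_mul.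
have Se : S <= e2 * e2.
  have h := nsub_bound n l x0 x1.
  have xl : 0 < x ^+ l by rewrite exprn_gt0.
  rewrite -(ler_pM2r xl); apply: le_trans h _.
  apply: le_trans (_ : e2 * (W * x ^+ l) <= _); last first.
    by rewrite -mulrA ler_wpM2l ?expR_ge0 // ler_wpM2r // ltW.
  rewrite -[leLHS]mulr1 ler_pM ?exprn_ge0 //; first by lra.
    rewrite /e2 expR_pow lerXn2r ?nnegrE ?expR_ge0 //; first by lra.
    by apply: le_trans (expR_ge1Dx _); lra.
  rewrite -exprMn exprn_ege1 //.
  by rewrite -(mulVf (lt0r_neq0 x0)) ler_wpM2r // ltW.
pose T := expR (- (mn * n%:R)).
have T0 : 0 < T by apply: expR_gt0.
(* From 1 - alpha <= exp (- alpha): here the rate alpha enters in place of - ln (1 - alpha). The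
   rate ln 2 enters through the powers of 1/2 in [hT]. *)
have bT : beta ^+ n <= T.
  rewrite /T -mulNr expR_pow lerXn2r ?nnegrE ?expR_ge0 //; first exact: ltW.
  by apply: le_trans (expR_ge1Dx _); rewrite /beta; lra.
have hT : 2^-1 ^+ n <= T.
  rewrite /T -mulNr expR_pow lerXn2r ?nnegrE ?expR_ge0 //.
  by rewrite -[2^-1]lnK ?posrE // lnV ?posrE // ler_expR; lra.
set g := N%:R ^+ n * kap ^+ (u * u).
have g0 : 0 <= g by rewrite mulr_ge0 ?exprn_ge0.
have gT : g <= K2 * T.
  have := K2P n; rewrite exprMn -/u -expR_pow => h.
  have TT : expR (mn * n%:R) * T = 1 by rewrite -expRD subrr expR0.
  have -> : g = (N%:R ^+ n * expR (mn * n%:R) * kap ^+ (u * u)) * T.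
    by rewrite -mulrA mulrACA TT mulr1.
  by rewrite ler_wpM2r // ltW.
(* Common majorant, up to constants, of the five terms [t1] to [t5]. *)
pose B := S ^+ 2 * W ^+ 2 * T.
have SW1 (p q : nat) : (p <= 2)%N -> (q <= 2)%N -> S ^+ p * W ^+ q * T <= B.
  by move=> p2 q2; rewrite ler_wpM2r ?(ltW T0) // ler_pM ?exprn_ge0 ?ler_weXn2l //; lra.
have S0' : 0 <= S by lra.
have W0 : 0 <= W by lra.
have [b0' T0'] : 0 <= beta /\ 0 <= T by split; apply: ltW.
have Nd_l : (N * d <= l)%N by rewrite /l /M /d mulnA leq_mul2r leq_addr orbT.
have u2_l : (2 * u <= l)%N by rewrite /l /M leq_mul2r leq_addl orbT.
have d_l : (d <= l)%N by apply: leq_trans Nd_l; rewrite leq_pmull.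
have sub_le j : (j <= l)%N -> beta ^+ (n - j) <= T * W.
  move=> jl; apply: le_trans (pow_sub_le b0 Zb Z1 jl ln) _.
  by rewrite ler_wpM2r.
have t1 : (nsub n (N * d))%:R * beta ^+ (n - N * d) *
    (nsub n (2 * u) * (2 ^ N * N ^ (N + (N * d + 2 * u))))%:R <= (2 ^ N * N ^ N)%:R * B.
  have e1 : (nsub n (2 * u) * (2 ^ N * N ^ (N + (N * d + 2 * u))))%:R <= (2 ^ N * N ^ N)%:R * (S * W).
    have -> : (nsub n (2 * u) * (2 ^ N * N ^ (N + (N * d + 2 * u))))%:R =
        (2 ^ N * N ^ N)%:R * ((nsub n (2 * u))%:R * (N%:R ^+ (N * d + 2 * u))) :> R.
      by rewrite -natrX -!natrM expnD; congr (_%:R); ring.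
    rewrite ler_wpM2l // ler_pM ?exprn_ge0 //; first by rewrite ler_nat nsub_mono.
    have -> : (N * d + 2 * u = l)%N by rewrite /l /M /d; ring.
    by rewrite lerXn2r ?nnegrE //; lra.
  apply: le_trans (_ : S * (T * W) * ((2 ^ N * N ^ N)%:R * (S * W)) <= _).
    rewrite ler_pM ?mulr_ge0 ?exprn_ge0 // ler_pM ?exprn_ge0 ?sub_le //.
    by rewrite ler_nat nsub_mono.
  by rewrite le_eqVlt; apply/orP; left; apply/eqP; rewrite /B; ring.
have t2 : (nsub n (N * d))%:R * beta ^+ (n - N * d) * g <= K2 * B.
  apply: le_trans (_ : S * 1 * (K2 * T) <= _).
    rewrite ler_pM ?mulr_ge0 ?exprn_ge0 // ler_pM ?exprn_ge0 ?exprn_ile1 //.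
    by rewrite ler_nat nsub_mono.
  rewrite mulr1 mulrCA ler_wpM2l ?(ltW K20) //.
  by have := SW1 1%N 0%N isT isT; rewrite expr1 expr0 mulr1.
have t3 : g <= K2 * B.
  apply: le_trans gT _; rewrite ler_wpM2l ?(ltW K20) //.
  by have := SW1 0%N 0%N isT isT; rewrite !expr0 !mul1r.
have sm1 : sm <= S * W.
  apply: le_trans smP _; rewrite natrM natrX ler_pM ?exprn_ge0 //.
    by rewrite ler_nat nsub_mono.
  apply: le_trans (_ : Z ^+ (2 * u) <= _); last by rewrite ler_weXn2l.
  by rewrite lerXn2r ?nnegrE //; lra.
have t4 : S0%:R * sm * beta ^+ (n - 2 * u) <= S0%:R * B.
  rewrite -mulrA ler_wpM2l //.
  apply: le_trans (_ : S * W * (T * W) <= _); first by rewrite ler_pM ?exprn_ge0 ?sub_le.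
  have := SW1 1%N 2%N isT isT; rewrite expr1 => h; apply: le_trans h.
  by rewrite le_eqVlt; apply/orP; left; apply/eqP; ring.
have t5 : S0%:R * sm * nc <= S0%:R * N%:R * B.
  rewrite -!mulrA ler_wpM2l //.
  apply: le_trans (_ : (S * W) * (N%:R * S * (T * W)) <= _).
    rewrite ler_pM //; apply: le_trans ncP _; rewrite natrM ler_pM ?mulr_ge0 ?exprn_ge0 //.
      by rewrite ler_wpM2l // ler_nat nsub_mono.
    have h2 : 0 < 2^-1 :> R by rewrite invr_gt0.
    apply: le_trans (pow_sub_le h2 Z2 Z1 d_l ln) _.
    by rewrite ler_wpM2r.
  by rewrite le_eqVlt; apply/orP; left; apply/eqP; rewrite /B; ring.
have BE : B <= expR (- (c * n%:R)).
  have -> : - (c * n%:R) = (eps * n%:R) *+ 8 + - (mn * n%:R).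
    by rewrite -mulrnAl /eps; field.
  rewrite expRD ler_wpM2r //.
  apply: le_trans (_ : (e2 * e2) ^+ 2 * e2 ^+ 2 <= _).
    have e20 : 0 <= e2 by apply: expR_ge0.
    have h1 : S ^+ 2 <= (e2 * e2) ^+ 2 by rewrite lerXn2r ?nnegrE ?mulr_ge0.
    have h2 : W ^+ 2 <= e2 ^+ 2 by rewrite lerXn2r ?nnegrE.
    by apply: ler_pM => //; apply: exprn_ge0.
  have e21 : 1 <= e2 by lra.
  have -> : expR (eps * n%:R *+ 8) = e2 ^+ 8 by rewrite -mulr_natl expRM_natl.
  by rewrite exprMn -!exprD ler_weXn2l.
apply: le_trans (_ : K1 * B <= _); last by rewrite ler_wpM2l // ltW.
rewrite mulrDr [S0%:R * sm * (_ + _)]mulrDr /K1 -/beta; lra.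
Qed.

End Asymptotics.

(** The laws are embedded in [R[i]], which contains the roots of unity; both sides of the resulting
    inequality are real, so it can be read back in R. As kap is chosen before n, it is uniform in
    n. *)
Lemma left_kernel_count_bound_real (R : realType) (alpha : R) (G : finZmodType) :
  0 < alpha -> alpha <= 1 ->
  exists kap : R, [/\ 0 <= kap, kap < 1 &
    forall (n : nat) (m : upper_index n -> 'Z_#|G| -> R),
      (forall e v, 0 <= m e v) -> (forall e, \sum_v m e v = 1) ->
      (forall e (y b : 'Z_#|G|), y != 0 -> y *+ #|G| = 0 ->
        \sum_v m e v * (y * v + b == 0)%:R <= 1 - alpha) ->
    forall d u, ((#|G| + 3) * u <= d)%N ->
  `|\sum_(F : {ffun 'I_n -> G} | generates #|G| F)
       Ex m (fun x => (in_left_kernel (@upper n) F x)%:R) - #|alt #|G| G|%:R| <=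
  (nsub n (#|G| * d))%:R * (1 - alpha) ^+ (n - #|G| * d) *
    ((nsub n (2 * u) * (2 ^ #|G| * #|G| ^ (#|G| + (#|G| * d + 2 * u))))%:R +
      #|G|%:R ^+ n * kap ^+ (u * u)) +
  (#|G|%:R ^+ n * kap ^+ (u * u) + #|skew #|G| G|%:R * #|small n #|G| G (2 * u)|%:R *
  ((1 - alpha) ^+ (n - 2 * u) +
    #|[set F : {ffun 'I_n -> G} | ~~ is_code #|G| F d]%SET|%:R / #|G|%:R ^+ n))].
Proof.
move=> a0 a1; set a := #|G|; have a_gt0 : (0 < a)%N by apply/card_gt0P; exists 0.
have [z z_prim] := @prim_root_exists R[i] (Zp_trunc a).+2 isT.
pose beta : R := 1 - alpha; have b0 : 0 <= beta by rewrite /beta; lra.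
have b1 : beta < 1 by rewrite /beta; lra.
have bC0 : 0 <= beta%:C%C by rewrite lecR.
have bC1 : beta%:C%C < 1 by rewrite ltcR.
have [kap [kap0 kap1 kapP]] := phase_bound z_prim bC0 bC1.
have /complex_realP[k kE] := ger0_real kap0; rewrite {}kE in kap0 kap1 kapP.
exists k; split; [by rewrite -lecR|by rewrite -ltcR|].
move=> n m m0 m1 mb d u du.
pose mC e v : R[i] := (m e v)%:C%C.
have mC0 e v : 0 <= mC e v by rewrite lecR.
have mC1 e : \sum_v mC e v = 1 by rewrite -rmorph_sum m1.
have mCb e (y b : 'Z_a) : y != 0 -> y *+ a = 0 ->
    \sum_v mC e v * (y * v + b == 0)%:R <= beta%:C%C.
  move=> y0 ya; have := mb e y b y0 ya; rewrite -lecR rmorph_sum.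
  by under eq_bigr => v _ do rewrite rmorphM /= rmorph_nat.
have mCk e (y : 'Z_a) : y != 0 -> y *+ a = 0 -> `|\sum_v mC e v * om z (y * v)| <= k%:C%C.
  by move=> y0 ya; apply: kapP => // b; apply: mCb.
have := @left_kernel_count_bound n (upper_index n) (@upper n) (@upperC n) (@upper_inj n) a G
  a_gt0 (@torsion_card G) R[i] z z_prim mC mC0 mC1 k%:C%C kap0 (ltW kap1) mCk
  beta%:C%C bC0 mCb d u (ltW bC1) du.
have -> : \sum_(F : {ffun 'I_n -> G} | generates a F) Ex mC (fun x => (in_left_kernel (@upper n) F x)%:R) =
    (\sum_(F : {ffun 'I_n -> G} | generates a F) Ex m (fun x => (in_left_kernel (@upper n) F x)%:R))%:C%C.
  rewrite rmorph_sum; apply: eq_bigr => F _; rewrite /Ex rmorph_sum; apply: eq_bigr => x _.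
  by rewrite rmorphM rmorph_prod /= rmorph_nat.
rewrite -lecR -[#|alt a G|%:R](rmorph_nat (real_complex R)) -rmorphB normc_def /=.
rewrite expr0n addr0 sqrtr_sqr => h; apply: le_trans h _.
by rewrite natrM !(rmorphD, rmorphM, rmorphXn, rmorph_nat, fmorphV, rmorphB, rmorph1).
Qed.

Theorem theorem6p1 (R : realType) (alpha : R) (G : finZmodType) (c : R)
    (alpha_gt0 : 0 < alpha) (alpha_lt1 : alpha < 1)
    (c_lt : c < Num.min alpha (ln 2)) :
  exists K : R, 0 < K /\
    forall (n : nat) (d : measure_display) (T : measurableType d)
      (P : probability T R) (X : T -> 'M[int]_n),
      random_symmetric_matrix P X ->
      (forall (p : nat) (t : 'F_p) (i j : 'I_n),
          prime p -> (p %| #|G|)%N -> (i <= j)%N ->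
          (P [set w | (X w i j)%:~R = t :> 'F_p] <= (1 - alpha)%:E)%E) ->
      (`| 'E_P[fun w => (num_elts (Sur (cok (X w)) G))%:R]
          - (num_elts [set: wedge2 G])%:R%:E |
       <= (K * expR (- (c * n%:R)))%:E)%E.
Proof.
have N0 : (0 < #|G|)%N by apply/card_gt0P; exists 0.
have [kap [kap0 kap1 bound]] := left_kernel_count_bound_real G alpha_gt0 (ltW alpha_lt1).
have [k [K K0 decay]] :=
  @error_decay R #|G| #|skew #|G| G| alpha kap c N0 alpha_gt0 alpha_lt1 kap0 kap1 c_lt.
exists K; split=> // n d T P X XP ball.
rewrite (expectation_Sur G XP) -card_alt -EFinB abse_EFin lee_fin.
have ball' := residue_law_ball XP (G := G) (ltW alpha_lt1) ball.
(* The distance [m] is the least one that [bound] allows for u, and k was fixed before n. *)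
set u := (n %/ k)%N; set m := ((#|G| + 3) * u)%N.
pose nc : R := #|[set F : {ffun 'I_n -> G} | ~~ is_code #|G| F m]%SET|%:R / #|G|%:R ^+ n.
have nc0 : 0 <= nc by rewrite divr_ge0 ?exprn_ge0.
have ncP : nc <= (#|G| * nsub n m)%:R * 2^-1 ^+ (n - m).
  rewrite ler_pdivrMr ?exprn_gt0 ?ltr0n // exprVn mulrAC ler_pdivlMr ?exprn_gt0 //.
  by rewrite -!natrX -!natrM ler_nat; apply: card_noncode => //; apply: torsion_card.
have smP : #|small n #|G| G (2 * u)|%:R <= (nsub n (2 * u) * #|G| ^ (2 * u))%:R :> R.
  by rewrite ler_nat; apply: card_small => //; apply: torsion_card.
apply: le_trans (decay n _ _ (ler0n _ _) nc0 smP ncP).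
exact: (bound n _ (@residue_law_ge0 _ _ _ P n X G) (@residue_law_sum _ _ _ P n X G XP) ball' m u (leqnn _)).
Qed.
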